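(* Let $n\ge 3$, $G=GL(n,\mathbb R)$, let $v\in\mathbb C^n$ satisfy $$\Re(v_1)<\Re(v_2)<\dots<\Re(v_n),$$ let $\sigma$ be a character of $M$, and let $\pi(v,\sigma)$ be the principal series representation defined over $G/MA\overline U$. Let $\rho=(\frac{n-1}{2},\frac{n-3}{2},\dots,-\frac{n-3}{2},-\frac{n-1}{2})$. Then for any $f\in\pi(v,\sigma)^\infty$ and any $l_i\in\mathbb N$, $i=1,\dots,n-1$, the function $$g\mapsto a^{-\rho-v}\prod_{i=1}^{n-1}\Bigl(\frac{a_i}{a_{i+1}}\Bigr)^{l_i}Wh_f(g)\qquad (g=uak,\ u\in U,\ a=\mathrm{diag}(a_1,\dots,a_n)\in A,\ k\in K)$$ is bounded on $G$ by a constant depending on $f$ and $l=(l_1,\dots,l_{n-1})$.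
   Context: $U$ (resp. $\overline U$) is the group of unipotent upper (resp. lower) triangular matrices in $G$, $A$ the group of positive diagonal matrices, $M=\{\mathrm{diag}(\pm1,\dots,\pm1)\}$, $K=O(n)$; every $g\in G$ is uniquely $g=uak$ (Iwasawa decomposition). For $\lambda\in\mathbb C^n$, $a^\lambda=\prod_{i=1}^n a_i^{\lambda_i}$; $\rho$ is the half sum of positive roots of $(\mathfrak a,\mathfrak u)$. $\pi(v,\sigma)^\infty$ is the space of smooth functions $f:G\to\mathbb C$ with $f(gma\overline u)=\sigma(m)^{-1}a^{\rho-v}f(g)$ for $m\in M$, $a\in A$, $\overline u\in\overline U$, with action $(\pi(v,\sigma)(g)f)(x)=f(g^{-1}x)$. For $v$ as in the claim, the restriction $f|_U$ of every $f\in\pi(v,\sigma)^\infty$ lies in $L^1(U)$ (with respect to the Euclidean measure $du=\prod_{i<j}du_{i,j}$). The Whittaker functional is given by integration against $\psi_{\mathbf 1}(u)=\exp\bigl(2\pi i\sum_{i=1}^{n-1}u_{i,i+1}\bigr)$, and the Whittaker function is $$Wh_f(g)=\langle\pi(v,\sigma)(g)f,\psi_{\mathbf 1}\rangle=\int_U f(g^{-1}x)\,\psi_{\mathbf 1}(x)\,dx .$$ *)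

(* Defs.v *)
From HB Require Import structures.
From mathcomp Require Import all_boot all_order all_algebra.
From mathcomp Require Import all_classical all_reals all_analysis.
From mathcomp Require Import complex.

Set Implicit Arguments.
Unset Strict Implicit.
Unset Printing Implicit Defensive.

Import Order.TTheory GRing.Theory Num.Theory.
Import numFieldNormedType.Exports.

Local Open Scope classical_set_scope.
Local Open Scope ring_scope.
Local Open Scope complex_scope.

Section LebesgueTuple.
Variable R : realType.
Local Notation RT := (measurableTypeR R).

Definition tcons N (p : RT * N.-tuple RT) : N.+1.-tuple RT :=
  [tuple of p.1 :: p.2].

Definition tuncons N (t : N.+1.-tuple RT) : RT * N.-tuple RT :=
  (thead t, [tuple of behead t]).

Lemma tconsK N : cancel (@tcons N) (@tuncons N).
Proof. by move=> [x t]; congr pair; exact/val_inj. Qed.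

Lemma tunconsK N : cancel (@tuncons N) (@tcons N).
Proof. by move=> t; rewrite [RHS]tuple_eta. Qed.

Lemma measurable_tcons N : measurable_fun [set: RT * N.-tuple RT] (@tcons N).
Proof. by apply: measurable_cons. Qed.

Lemma measurable_tuncons N : measurable_fun [set: N.+1.-tuple RT] (@tuncons N).
Proof.
apply: (@measurable_fun_pair _ _ _ _ _ _ (@thead _ RT)
         (fun t => [tuple of behead t])).
  exact: (@measurable_tnth _ RT _ ord0).
exact: measurable_behead.
Qed.

(* Lebesgue measure on R^N: the N-fold product of [lebesgue_measure]. *)
Fixpoint lebesgue_tuple {N : nat} : set (N.-tuple RT) -> \bar R :=
  match N return set (N.-tuple RT) -> \bar R with
  | 0%N => @dirac _ (0.-tuple RT) [tuple] R
  | N'.+1 =>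
      pushforward
        ((@lebesgue_measure R : set RT -> \bar R) \x @lebesgue_tuple N')%E
        (@tcons N')
  end.

Section step.
Variables (N : nat) (mu : {sigma_finite_measure set (N.-tuple RT) -> \bar R}).

Let leb : {sigma_finite_measure set RT -> \bar R} := @lebesgue_measure R.
Let nu : {measure set (RT * N.-tuple RT)%type -> \bar R} := (leb \x mu)%E.
Definition tcons_product := pushforward nu (@tcons N).

HB.instance Definition _ := Measure.copy tcons_product
  (measure_function_pushforward__canonical__measure_function_Measure
    nu (@measurable_tcons N)).

Let tcons_product_sigma_finite : sigma_finite setT tcons_product.
Proof.
have /sigma_finiteP[F [TF ndF Foo]] := sigma_finiteT leb.
have /sigma_finiteP[G [TG ndG Goo]] := sigma_finiteT mu.
exists (fun k => @tuncons N @^-1` (F k `*` G k)).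
  rewrite -preimage_bigcup (_ : \bigcup_k _ = setT) ?preimage_setT//.
  apply/seteqP; split=> // -[x t] _.
  have [i _ Fx] : (\bigcup_k F k) x by rewrite -TF.
  have [j _ Gt] : (\bigcup_k G k) t by rewrite -TG.
  exists (maxn i j) => //; split=> /=.
    by move: x Fx; exact/subsetPset/ndF/leq_maxl.
  by move: t Gt; exact/subsetPset/ndG/leq_maxr.
move=> k; have [mF Fk] := Foo k; have [mG Gk] := Goo k; split.
  rewrite -[X in measurable X]setTI; apply: measurable_tuncons => //.
  exact: measurableX.
rewrite /tcons_product /pushforward (_ : _ @^-1` _ = F k `*` G k); last first.
  by rewrite -comp_preimage (_ : @tuncons N \o @tcons N = id)//; apply/funext/tconsK.
by rewrite /nu /= product_measure1E// lte_mul_pinfty// ge0_fin_numE.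
Qed.

HB.instance Definition _ := Measure_isSigmaFinite.Build _ _ _
  tcons_product tcons_product_sigma_finite.

Lemma lebesgue_tuple_step :
  exists m' : {sigma_finite_measure set (N.+1.-tuple RT) -> \bar R},
    pushforward (@lebesgue_measure R \x mu)%E (@tcons N) = m'.
Proof. by exists tcons_product. Qed.

End step.

Lemma lebesgue_tuple_sigma_finite_measure N :
  exists mu : {sigma_finite_measure set (N.-tuple RT) -> \bar R},
    @lebesgue_tuple N = mu.
Proof.
elim: N => [|N [mu muE]] /=; first by exists (@dirac _ (0.-tuple RT) [tuple] R).
by rewrite muE; exact: lebesgue_tuple_step.
Qed.

Let lebesgue_tuple0 N : @lebesgue_tuple N set0 = 0%E.
Proof.
by have [mu ->] := lebesgue_tuple_sigma_finite_measure N; rewrite measure0.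
Qed.

Let lebesgue_tuple_ge0 N A : (0 <= @lebesgue_tuple N A)%E.
Proof. by have [mu ->] := lebesgue_tuple_sigma_finite_measure N. Qed.

Let lebesgue_tuple_sigma_additive N : semi_sigma_additive (@lebesgue_tuple N).
Proof.
have [mu ->] := lebesgue_tuple_sigma_finite_measure N.
exact: measure_semi_sigma_additive.
Qed.

HB.instance Definition _ N := isMeasure.Build _ _ _ (@lebesgue_tuple N)
  (@lebesgue_tuple0 N) (@lebesgue_tuple_ge0 N)
  (@lebesgue_tuple_sigma_additive N).

Let lebesgue_tuple_sigma_finite N : sigma_finite setT (@lebesgue_tuple N).
Proof.
have [mu ->] := lebesgue_tuple_sigma_finite_measure N; exact: sigma_finiteT.
Qed.

HB.instance Definition _ N := Measure_isSigmaFinite.Build _ _ _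
  (@lebesgue_tuple N) (@lebesgue_tuple_sigma_finite N).

Lemma lebesgue_tuple_box N (A : 'I_N -> set RT) :
  (forall i, measurable (A i)) ->
  lebesgue_tuple [set t : N.-tuple RT | forall i, A i (tnth t i)] =
  (\prod_(i < N) lebesgue_measure (A i))%E.
Proof.
elim: N A => [|N IH] A mA.
  rewrite big_ord0 /= diracE mem_set//; by case.
rewrite big_ord_recl -IH => [|i]; last exact: mA.
rewrite /= /pushforward.
set B := [set t : N.-tuple RT | _].
rewrite (_ : _ @^-1` _ = A ord0 `*` B); last first.
  apply/seteqP; split=> -[x t] /=.
    by move=> At; split=> [|i]; [exact: (At ord0)|have := At (lift ord0 i); rewrite tnthS].
  move=> [Ax Bt] i; have [j ->|->] := unliftP ord0 i; last by rewrite tnth0.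
  by rewrite tnthS.
rewrite product_measure1E//.
rewrite (_ : B = \bigcap_(i in [set: 'I_N]) ((@tnth N RT)^~ i @^-1` A (lift ord0 i))).
  apply: fin_bigcap_measurable => // i _.
  by rewrite -[X in measurable X]setTI; exact: measurable_tnth.
by apply/seteqP; split=> [t Bt i _|t Bt i]; [exact: Bt|exact: Bt].
Qed.

End LebesgueTuple.

Section Smooth.
Variables (R : realType) (V : normedModType R).

(* [Ck_on k D f] is the usual notion of C^k only when D is open: all iterated
   directional derivatives up to order k exist and are continuous on D; values
   of f outside of D are then irrelevant. *)
Fixpoint Ck_on (k : nat) (D : set V) (f : V -> R) : Prop :=
  (forall x, D x -> {for x, continuous f}) /\
  match k with
  | 0%N => True
  | k'.+1 => forall w : V, (forall x, D x -> derivable f x w) /\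
                           Ck_on k' D (fun x => 'D_w f x)
  end.

Definition smooth_on (D : set V) (f : V -> R[i]) : Prop :=
  forall k, Ck_on k D (fun x => complex.Re (f x)) /\
            Ck_on k D (fun x => complex.Im (f x)).

End Smooth.

Section ComplexAnalysis.
Variable R : realType.

Definition cexp (z : R[i]) : R[i] :=
  (expR (complex.Re z))%:C *
  (cos (complex.Im z) +i* sin (complex.Im z)).

(* x^z for x > 0 *)
Definition cpow (x : R) (z : R[i]) : R[i] := cexp (z * (ln x)%:C).

Definition cintegral d (T : measurableType d) (mu : {measure set T -> \bar R})
    (F : T -> R[i]) : R[i] :=
  (\int[mu]_(x in setT) complex.Re (F x)) +i*
  (\int[mu]_(x in setT) complex.Im (F x)).

End ComplexAnalysis.

(* For i < n - 1, the consecutive indices i and i + 1 of 'I_n. *)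
Definition ord_lo n (i : 'I_n.-1) : 'I_n := widen_ord (leq_pred n) i.

Lemma ord_hi_subproof n (i : 'I_n.-1) : (i.+1 < n)%N.
Proof. by rewrite -ltn_predRL. Qed.

Definition ord_hi n (i : 'I_n.-1) : 'I_n := Ordinal (ord_hi_subproof i).

Section GroupGL.
Variables (R : realType) (n : nat).

Definition GL : set 'M[R]_n := [set g | g \in unitmx].

Definition unipU : set 'M[R]_n :=
  [set u | (forall i, u i i = 1) /\ (forall i j : 'I_n, (j < i)%N -> u i j = 0)].

Definition unipUbar : set 'M[R]_n :=
  [set u | (forall i, u i i = 1) /\ (forall i j : 'I_n, (i < j)%N -> u i j = 0)].

Definition torusA : set 'M[R]_n :=
  [set a | is_diag_mx a /\ forall i, 0 < a i i].

Definition signM : set 'M[R]_n :=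
  [set m | is_diag_mx m /\ forall i, m i i = 1 \/ m i i = -1].

Definition orthoK : set 'M[R]_n := [set k | k *m k^T = 1%:M].

Definition apow (a : 'M[R]_n) (lam : 'I_n -> R[i]) : R[i] :=
  \prod_(i < n) cpow (a i i) (lam i).

(* With i counted from 0: ((n-1)/2, (n-3)/2, ..., -(n-1)/2). *)
Definition rho (i : 'I_n) : R[i] := ((n%:R - 1 - 2 * i%:R) / 2 : R)%:C.

Definition is_character (sigma : 'M[R]_n -> R[i]) : Prop :=
  sigma 1%:M = 1 /\
  forall m1 m2, signM m1 -> signM m2 -> sigma (m1 *m m2) = sigma m1 * sigma m2.

(* f represents an element of pi(v, sigma)^infty; only its values on GL(n, R)
   matter. *)
Definition principal_series (v : 'I_n -> R[i]) (sigma : 'M[R]_n -> R[i])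
    (f : 'M[R]_n -> R[i]) : Prop :=
  smooth_on GL f /\
  forall g m a ubar, GL g -> signM m -> torusA a -> unipUbar ubar ->
    f (g *m m *m a *m ubar) =
    (sigma m)^-1 * apow a (fun i => rho i - v i) * f g.

Definition pi_action (g : 'M[R]_n) (f : 'M[R]_n -> R[i]) : 'M[R]_n -> R[i] :=
  fun x => f (invmx g *m x).

(* The entries u_{i,j}, i < j, are numbered column by column: column j (counted
   from 0) has j of them, and starts at index 0 + 1 + ... + (j-1) = 'C(j, 2).
   This identifies U with R^N, N = 'C(n, 2). *)
Definition unip_mx (t : 'C(n, 2).-tuple (measurableTypeR R)) : 'M[R]_n :=
  \matrix_(i, j) if (i < j)%N then nth 0 t ('C(j, 2) + i) else (i == j)%:R.

Definition integralU (F : 'M[R]_n -> R[i]) : R[i] :=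
  cintegral (@lebesgue_tuple R 'C(n, 2)) (fun t => F (unip_mx t)).

Definition psi1 (u : 'M[R]_n) : R[i] :=
  cexp (0 +i* (2 * pi * \sum_(i < n.-1) u (ord_lo i) (ord_hi i))).

Definition whittaker (f : 'M[R]_n -> R[i]) (g : 'M[R]_n) : R[i] :=
  integralU (fun x => pi_action g f x * psi1 x).

End GroupGL.

(* Main.v *)
Require Import Defs.
From mathcomp Require Import all_boot all_order all_algebra.
From mathcomp Require Import all_classical all_reals all_analysis.
From mathcomp Require Import complex.
From mathcomp Require Import perm measurable_realfun ring lra zify.

(* Write g = u a k. The substitution x = u a y a^-1 turns a^(-rho - v) Wh_f(g), up to a
   factor of modulus 1, into W = int_U f(k^-1 y) exp(2 pi i sum_i t_i y_(i,i+1)) dy with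
   t_i = a_i / a_(i+1). Let t be the largest t_i, attained at the simple root vector X, and
   let s = 1 / (2 t). Left translation by 1 + s X changes the sign of the exponential, so
   replacing y |-> f(k^-1 y) by its L-th difference for this translation multiplies the
   integral by 2^L. As X^2 = 0 this is a finite difference of f along a straight line, of
   size O(s^L) on K by smoothness and compactness; hence t^L |W| is bounded.
   The integrals converge: if y = kappa b with b lower triangular, the products of the
   last diagonal entries of b are volumes spanned by the last columns of y. Running
   Gram--Schmidt from the last column gives coordinates z on U which are a triangular,
   volume preserving change of variables and in which |b^(rho - v)| is at most
   prod (1 + z_k^2)^(-(1 + eps) / 2). *)


Set Implicit Arguments.
Unset Strict Implicit.
Unset Printing Implicit Defensive.

Import Order.TTheory GRing.Theory Num.Theory.
Import numFieldNormedType.Exports.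

Local Open Scope classical_set_scope.
Local Open Scope ring_scope.
Local Open Scope complex_scope.

(** * Triangular changes of variables *)

(** Differences are used instead of integration by parts because they require only the invariance of
    the measure on U under left translation. Left translation commutes with the right action of A
    and of the lower unipotent group, so a difference of f has the same covariance as f, and its
    bound on K spreads to U with the same integrable majorant. The substitution yields the Jacobian
    a^(2 rho), and covariance yields a^(-(rho - v)); in modulus both cancel against the prefactor
    a^(-rho - v). What remains is the product of the t_i^(l_i), at most max(1, t^L) with L the sum
    of the l_i. The step s must stay below 1, so the case t <= 1 is settled separately by the
    undifferenced bound. All changes of variables on U have one shape: with entries numbered column
    by column, each coordinate is mapped affinely with coefficients depending on later coordinates
    only, so Tonelli and one-variable dilations suffice. The number eps is a lower bound for the
    gaps between the real parts of the v_i, and rho contributes the 1 in 1 + eps, which puts the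
    exponent just beyond the threshold of integrability on the line. *)

Section TriangularChangeOfVariables.
Variable R : realType.
Local Notation RT := (measurableTypeR R).
Local Notation leb := (@lebesgue_measure R).
Local Open Scope ereal_scope.

Let affine (c b x : RT) : RT := (c * x + b)%R.

Let measurable_affine c b : measurable_fun setT (affine c b).
Proof. exact: measurable_funD. Qed.

Lemma ge0_integral_affine (c b : R) (F : RT -> \bar R) : (0 < c)%R ->
  measurable_fun setT F -> (forall x, 0 <= F x) ->
  \int[leb]_x (F (c * x + b)%R * c%:E) = \int[leb]_x F x.
Proof.
move=> c0 mF F0.
pose m : {measure set RT -> \bar R} :=
  mscale (NngNum (ltW c0))
    (measure_function_pushforward__canonical__measure_function_Measure
       leb (measurable_affine c b)).
(* Lebesgue measure is determined by half-open intervals, where the rescaled image measure is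
   computed directly. *)
have E A : measurable A -> leb A = m A.
  apply: lebesgue_measure_unique => _ [[x y] _ <-].
  rewrite /m/= /mscale/= /pushforward.
  rewrite (_ : affine c b @^-1` `]x, y] = [set` `](x - b) / c, (y - b) / c]%R]); last first.
    apply/seteqP; split=> z /=; rewrite !in_itv/= /affine ltr_pdivrMr// ler_pdivlMr//;
      by rewrite ltrBlDr lerBrDr mulrC.
  rewrite !lebesgue_measure_itv/= !lte_fin ltr_pM2r ?invr_gt0// ltrD2r.
  case: ifPn => _; last by rewrite mule0.
  rewrite -EFinB -EFinM; congr EFin.
  by field; rewrite gt_eqF.
transitivity (\int[m]_x F x).
  rewrite ge0_integral_mscale//=.
  rewrite ge0_integral_pushforward//=.
  rewrite preimage_setT -ge0_integralZl//=.
  - by apply: eq_integral => x _; rewrite muleC.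
  - exact: measurableT_comp.
  - by rewrite lee_fin ltW.
by apply: eq_measure_integral => //= A mA _; rewrite E.
Qed.

Lemma ge0_integral_tcons N (F : N.+1.-tuple RT -> \bar R) :
  measurable_fun setT F -> (forall t, 0 <= F t) ->
  measurable_fun setT (fun t : N.-tuple RT => \int[leb]_x F (tcons (x, t))) /\
  \int[@lebesgue_tuple R N.+1]_t F t =
  \int[@lebesgue_tuple R N]_t \int[leb]_x F (tcons (x, t)).
Proof.
move=> mF F0.
have mFc : measurable_fun setT (F \o @tcons R N).
  by apply: measurableT_comp => //; exact: measurable_tcons.
pose P : {measure set (RT * N.-tuple RT)%type -> \bar R} :=
  (leb \x @lebesgue_tuple R N).
split.
  have := @measurable_fun_fubini_tonelli_G _ _ _ _ R leb _ mFc.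
  by apply => *; exact: F0.
transitivity
  (\int[measure_function_pushforward__canonical__measure_function_Measure
           P (@measurable_tcons R N)]_t F t).
  exact: eq_measure_integral.
rewrite ge0_integral_pushforward//=; last exact: measurable_tcons.
by rewrite (@fubini_tonelli2 _ _ _ _ R leb (@lebesgue_tuple R N) (F \o @tcons R N))//=.
Qed.


(** Coordinate 0 is the head of the tuple and is integrated innermost; with this orientation no
    coefficient involves it, so it can be peeled off first. *)
Definition depends_after N (k : 'I_N) (p : N.-tuple RT -> R) :=
  forall t t', (forall m : 'I_N, (k < m)%N -> tnth t m = tnth t' m) -> p t = p t'.

Definition triangular_map N (a b : 'I_N -> N.-tuple RT -> R) (t : N.-tuple RT) :
    N.-tuple RT :=
  [tuple (a k t * tnth t k + b k t)%R | k < N].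

Lemma measurable_triangular_map N (a b : 'I_N -> N.-tuple RT -> R) :
  (forall k, measurable_fun setT (a k)) -> (forall k, measurable_fun setT (b k)) ->
  measurable_fun setT (triangular_map a b).
Proof.
move=> ma mb; apply/measurable_fun_tnthP => k.
apply: (eq_measurable_fun (fun t => (a k t * tnth t k + b k t)%R)).
  by move=> t _; rewrite /= tnth_mktuple.
apply: measurable_funD => //; apply: measurable_funM => //.
exact: measurable_tnth.
Qed.

Lemma tcons_agree_after N (k : 'I_N) x (t t' : N.-tuple RT) :
  (forall m : 'I_N, (k < m)%N -> tnth t m = tnth t' m) ->
  forall m : 'I_N.+1, (lift ord0 k < m)%N ->
  tnth (tcons (x, t)) m = tnth (tcons (x, t')) m.
Proof.
move=> tt' m; have [j ->|->//] := unliftP ord0 m.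
by rewrite !tnthS => /tt'.
Qed.

(** Once the tail is fixed, the map is affine in the head with constant slope, and
    [ge0_integral_affine] integrates the head out; the tail is again mapped triangularly, which
    gives the induction. *)
Lemma ge0_integral_triangular_map N (a b : 'I_N -> N.-tuple RT -> R) :
  (forall k, measurable_fun setT (a k)) -> (forall k, measurable_fun setT (b k)) ->
  (forall k, depends_after k (a k)) -> (forall k, depends_after k (b k)) ->
  (forall k t, (0 < a k t)%R) ->
  forall F : N.-tuple RT -> \bar R, measurable_fun setT F -> (forall t, 0 <= F t) ->
  \int[@lebesgue_tuple R N]_t
    (F (triangular_map a b t) * (\prod_(k < N) a k t)%R%:E) =
  \int[@lebesgue_tuple R N]_t F t.
Proof.
elim: N a b => [|N IH] a b ma mb da db a0 F mF F0.
  by apply: eq_integral => t _; rewrite big_ord0 mule1 [in LHS]tuple0 [in RHS]tuple0.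
have mS := measurable_triangular_map ma mb.
rewrite (proj2 (@ge0_integral_tcons _ F mF F0)).
rewrite (proj2 (@ge0_integral_tcons _ _ _ _)); first last.
- by move=> t; rewrite mule_ge0// lee_fin prodr_ge0// => k _; exact: ltW.
- apply: emeasurable_funM; first exact: measurableT_comp.
  by apply/measurable_EFinP; exact: measurable_prod.
(* The head 0 is a dummy: by [depends_after] the coefficients take the same value for every head. *)
pose a' k (t : N.-tuple RT) := a (lift ord0 k) (tcons (0%R, t)).
pose b' k (t : N.-tuple RT) := b (lift ord0 k) (tcons (0%R, t)).
have mc : measurable_fun setT (fun t : N.-tuple RT => tcons (0%R : RT, t)).
  by apply: measurableT_comp; [exact: measurable_tcons|exact: measurable_pair1].
have ma' k : measurable_fun setT (a' k) by exact: measurableT_comp.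
have mb' k : measurable_fun setT (b' k) by exact: measurableT_comp.
have da' k : depends_after k (a' k).
  by move=> t t' tt'; apply: da; exact: tcons_agree_after.
have db' k : depends_after k (b' k).
  by move=> t t' tt'; apply: db; exact: tcons_agree_after.
pose F' (t : N.-tuple RT) := \int[leb]_x F (tcons (x, t)).
have mF' : measurable_fun setT F' by have [] := @ge0_integral_tcons _ F mF F0.
have F'0 t : 0 <= F' t by apply: integral_ge0.
rewrite -(IH a' b' ma' mb' da' db' _ F' mF' F'0); last by move=> k t; exact: a0.
apply: eq_integral => t _.
set P := (\prod_(k < N) a' k t)%R.
have P0 : (0 <= P)%R by apply: prodr_ge0 => k _; exact/ltW/a0.
set c := a ord0 (tcons (0%R, t)); set d := b ord0 (tcons (0%R, t)).
have same_tail x (m : 'I_N.+1) : (0 < m)%N ->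
    tnth (tcons (x, t)) m = tnth (tcons (0%R, t)) m.
  by have [j ->|->//] := unliftP ord0 m; rewrite !tnthS.
have aE x k : a k (tcons (x, t)) = a k (tcons (0%R, t)).
  by apply: da => m km; apply: same_tail; exact: leq_ltn_trans km.
have bE x k : b k (tcons (x, t)) = b k (tcons (0%R, t)).
  by apply: db => m km; apply: same_tail; exact: leq_ltn_trans km.
have SE x : triangular_map a b (tcons (x, t)) =
    tcons ((c * x + d)%R : RT, triangular_map a' b' t).
  apply: eq_from_tnth => m; rewrite tnth_mktuple aE bE.
  have [j ->|->] := unliftP ord0 m; last by rewrite tnth0.
  by rewrite !tnthS tnth_mktuple.
under eq_integral => x _.
  rewrite SE big_ord_recl aE -/c.
  under eq_bigr => k _ do rewrite aE.
  rewrite EFinM muleA.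
  over.
rewrite ge0_integralZr//=; first last.
- by move=> x _; rewrite mule_ge0// lee_fin; exact/ltW/a0.
- apply: emeasurable_funM => //.
  apply: measurableT_comp => //.
  apply: measurableT_comp; first exact: measurable_tcons.
  apply: measurable_fun_pair => //.
  exact: measurable_funD.
congr (_ * _); rewrite -[RHS](@ge0_integral_affine c d _ (a0 _ _))//.
by apply: measurableT_comp => //; apply: measurableT_comp;
  [exact: measurable_tcons | exact: measurable_pair2].
Qed.

End TriangularChangeOfVariables.

(** * Gram--Schmidt from the last column *)

Section GramSchmidt.
Variables (R : realFieldType) (n : nat).
Implicit Types (x y z : nat -> R) (eta : nat -> nat -> R).

Definition dot x y : R := \sum_(0 <= r < n) x r * y r.

Lemma dotC x y : dot x y = dot y x.
Proof. by apply: eq_bigr => r _; rewrite mulrC. Qed.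

Lemma dot_sumr x (I : Type) (s : seq I) (a : I -> R) (z : I -> nat -> R) :
  dot x (fun r => \sum_(i <- s) a i * z i r) = \sum_(i <- s) a i * dot x (z i).
Proof.
rewrite /dot; under eq_bigr do rewrite mulr_sumr.
rewrite exchange_big; apply: eq_bigr => i _; rewrite mulr_sumr.
by apply: eq_bigr => r _; ring.
Qed.

Lemma dot_sublr x y a z : dot x (fun r => y r - a * z r) = dot x y - a * dot x z.
Proof.
rewrite /dot mulr_sumr -sumrB; apply: eq_bigr => r _; ring.
Qed.

Lemma dotE x y c : (c < n)%N -> (forall r, (r < n)%N -> r != c -> x r * y r = 0) ->
  dot x y = x c * y c.
Proof.
move=> cn xy0; rewrite /dot (bigD1_seq c)//= ?mem_index_iota ?iota_uniq//.
rewrite big1_seq ?addr0// => r /andP[rc].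
by rewrite mem_index_iota => /andP[_ rn]; exact: xy0.
Qed.

(** For an orthogonal family [eta] and a new column [y], [gs_vec c eta y j] is the orthogonal
    projection of [y] on the span of [eta j], ..., [eta c], and [gs_tau c eta y j] is its squared
    norm. *)
Definition gs_coef eta y i : R := dot (eta i) y.
Definition gs_nrm eta i : R := dot (eta i) (eta i).
Definition gs_tau c eta y j : R :=
  \sum_(j <= i < c.+1) gs_coef eta y i ^+ 2 / gs_nrm eta i.
Definition gs_vec c eta y j : nat -> R :=
  fun r => \sum_(j <= i < c.+1) gs_coef eta y i / gs_nrm eta i * eta i r.
(** From each [eta i] the multiple of the projection of [y] on the later vectors is removed that
    makes the result orthogonal to [y]. Only vectors with larger index are subtracted, which
    preserves the unitriangular shape. *)
Definition gs_step c eta y : nat -> nat -> R := fun i r =>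
  eta i r - gs_coef eta y i / gs_tau c eta y i.+1 * gs_vec c eta y i.+1 r.

(** Unitriangularity means that [eta j], ..., [eta m.-1] live on the rows from j on, so the same
    family also handles the columns truncated to these rows. *)
Definition gs_ortho m eta :=
  [/\ forall i, (i < m)%N -> eta i i = 1,
      forall i r, (i < m)%N -> (r < i)%N -> eta i r = 0 &
      forall i j, (i < m)%N -> (j < m)%N -> i != j -> dot (eta i) (eta j) = 0].

Section Step.
Variables (c : nat) (eta : nat -> nat -> R) (y : nat -> R).
Hypothesis cn : (c < n)%N.
Hypothesis oeta : gs_ortho c.+1 eta.
Hypothesis yc : y c = 1.
Hypothesis yr : forall r, (c < r)%N -> y r = 0.

Local Notation s := (gs_coef eta y).
Local Notation h := (gs_nrm eta).
Local Notation tau := (gs_tau c eta y).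
Local Notation v := (gs_vec c eta y).
Local Notation eta' := (gs_step c eta y).

Lemma gs_nrm_ge1 i : (i <= c)%N -> 1 <= h i.
Proof.
move=> ic; have [e1 _ _] := oeta.
rewrite /gs_nrm /dot (bigD1_seq i)/= ?mem_index_iota ?iota_uniq//; last first.
  exact: leq_ltn_trans cn.
rewrite e1// mulr1 lerDl sumr_ge0// => r _; exact: sqr_ge0.
Qed.

Lemma gs_nrm_gt0 i : (i <= c)%N -> 0 < h i.
Proof. by move=> ic; rewrite (lt_le_trans ltr01)// gs_nrm_ge1. Qed.

(** The supports of [eta c] and [y] meet only in row c. This unit coefficient keeps every [tau]
    positive, so that [gs_step] never divides by zero. *)
Lemma gs_coef_last : s c = 1.
Proof.
have [e1 e0 _] := oeta.
rewrite /gs_coef (dotE (c := c))//.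
  by rewrite e1// yc mulr1.
move=> r rn; rewrite neq_ltn => /orP[rc|cr]; first by rewrite e0// mul0r.
by rewrite yr// mulr0.
Qed.

Lemma gs_tau_gt0 j : (j <= c)%N -> 0 < tau j.
Proof.
move=> jc; rewrite /gs_tau big_nat_recr//= gs_coef_last expr1n.
rewrite ltr_wpDl// ?divr_gt0// ?gs_nrm_gt0//.
rewrite big_nat_cond sumr_ge0// => i; rewrite andbT => /andP[_ ic].
by rewrite divr_ge0 ?sqr_ge0// ltW// gs_nrm_gt0// ltnW.
Qed.

Lemma gs_tau_rec j : (j <= c)%N -> tau j = s j ^+ 2 / h j + tau j.+1.
Proof. by move=> jc; rewrite /gs_tau big_ltn. Qed.

Lemma dot_gs_vec x j : dot x (v j) =
  \sum_(j <= i < c.+1) s i / h i * dot x (eta i).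
Proof. exact: dot_sumr. Qed.

Lemma dot_eta_vec i j : (i <= c)%N -> dot (eta i) (v j) = if (j <= i)%N then s i else 0.
Proof.
move=> ic; have [_ _ eo] := oeta; rewrite dot_gs_vec; case: ifPn => [ji|].
  rewrite (bigD1_seq i)/= ?mem_index_iota ?iota_uniq// ?ji ?ltnS//.
  rewrite big1_seq ?addr0 ?divfK ?gt_eqF ?gs_nrm_gt0// => k /andP[ki].
  by rewrite mem_index_iota => /andP[_ kc]; rewrite eo ?mulr0// eq_sym.
rewrite -ltnNge => ij; rewrite big1_seq// => k.
rewrite mem_index_iota => /andP[_ /andP[jk kc]]; rewrite eo ?mulr0//.
by rewrite neq_ltn (leq_trans ij jk).
Qed.

Lemma dot_vec_y j : dot (v j) y = tau j.
Proof.
rewrite dotC dot_gs_vec; apply: eq_bigr => i _.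
by rewrite dotC -/(s i) expr2 mulrAC.
Qed.

Lemma dot_vec_vec i j : (i <= j)%N -> dot (v i) (v j) = tau j.
Proof.
move=> ij; rewrite dot_gs_vec; apply: eq_big_nat => k /andP[jk kc].
by rewrite dotC dot_eta_vec// (leq_trans ij jk) mulrAC expr2.
Qed.

Lemma gs_step_dot_y i : (i < c)%N -> dot (eta' i) y = 0.
Proof.
move=> ic; rewrite dotC dot_sublr dotC -/(s i) (dotC y) dot_vec_y divfK ?subrr//.
by rewrite gt_eqF// gs_tau_gt0.
Qed.

Lemma gs_step_dot_vec0 i : (i < c)%N -> dot (eta' i) (v 0) = 0.
Proof.
move=> ic; have ic' := ltnW ic.
rewrite dotC dot_sublr dotC dot_eta_vec//=.
by rewrite dot_vec_vec// divfK ?subrr// gt_eqF// gs_tau_gt0.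
Qed.

Lemma gs_step_perp x : (forall i, (i <= c)%N -> dot (eta i) x = 0) ->
  forall i, (i < c)%N -> dot (eta' i) x = 0.
Proof.
move=> x0 i ic; rewrite dotC dot_sublr dotC x0 1?ltnW// dot_gs_vec.
rewrite big1_seq ?mulr0 ?subrr// => k; rewrite mem_index_iota => /andP[_ /andP[_ kc]].
by rewrite dotC x0// mulr0.
Qed.

(** For i < j, the products of [eta' i] with [eta j] and with [v j.+1] are - s_i s_j / tau_(i+1) and
    - s_i tau_(j+1) / tau_(i+1); the correction s_j / tau_(j+1) makes them cancel. *)
Lemma gs_step_dot i j : (i < c)%N -> (j < c)%N -> (i <= j)%N ->
  dot (eta' i) (eta' j) = if i == j then h i + s i ^+ 2 / tau i.+1 else 0.
Proof.
move=> ic jc ij; have [_ _ eo] := oeta.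
have ic' := ltnW ic; have jc' := ltnW jc.
have tj : tau j.+1 != 0 by rewrite gt_eqF// gs_tau_gt0.
have ti : tau i.+1 != 0 by rewrite gt_eqF// gs_tau_gt0.
have vj : dot (eta' i) (v j.+1) = - (s i / tau i.+1 * tau j.+1).
  rewrite dotC dot_sublr (dotC (v _) (eta i)) dot_eta_vec//.
  by rewrite ltnNge ij/= sub0r (dotC (v j.+1)) dot_vec_vec.
have ej : dot (eta' i) (eta j) = if i == j then h i else - (s i / tau i.+1 * s j).
  rewrite dotC dot_sublr dot_eta_vec//; case: eqVneq => [->|ij'].
    by rewrite ltnn mulr0 subr0.
  rewrite eo//; last by rewrite eq_sym.
  by rewrite ltn_neqAle ij' ij sub0r.
rewrite dot_sublr vj ej; case: eqVneq => [<-|_].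
  by field.
by field; rewrite ti tj.
Qed.

Lemma gs_step_nrm i : (i < c)%N -> gs_nrm eta' i = h i + s i ^+ 2 / tau i.+1.
Proof. by move=> ic; rewrite /gs_nrm gs_step_dot// eqxx. Qed.

Lemma gs_step_ortho : gs_ortho c eta'.
Proof.
have [e1 e0 _] := oeta.
have v0 j r : (r < j)%N -> v j r = 0.
  move=> rj; rewrite /gs_vec big1_seq// => k; rewrite mem_index_iota => /andP[_ /andP[jk kc]].
  by rewrite e0 ?mulr0//; exact: leq_trans jk.
split => [i ic|i r ic ri|i j ic jc ij].
- by rewrite /gs_step v0// mulr0 subr0 e1// ltnW.
- by rewrite /gs_step v0 ?mulr0 ?subr0 ?e0//; lia.
- have [le|lt] := leqP i j; first by rewrite gs_step_dot// (negbTE ij).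
  by rewrite dotC gs_step_dot// 1?ltnW// eq_sym (negbTE ij).
Qed.

(** Each new squared norm equals h_i tau_i / tau_(i+1), so the product telescopes down from tau_c =
    1 / h_c. This is the growth of a Gram determinant when one column is adjoined. *)
Lemma gs_tau_prod j : (j <= c)%N ->
  tau j * \prod_(j <= i < c.+1) h i = \prod_(j <= i < c) gs_nrm eta' i.
Proof.
move=> jc; rewrite -(subKn jc); move: (c - j)%N (leq_subr j c) => k.
elim: k => [_|k IH kc].
  rewrite subn0 [RHS]big_geq// big_nat1 /gs_tau big_nat1 gs_coef_last expr1n.
  by rewrite div1r mulVf// gt_eqF// gs_nrm_gt0.
have ck : (c - k = (c - k.+1).+1)%N by lia.
have kc' : (c - k.+1 < c)%N by lia.
have := IH (ltnW kc); rewrite ck => {}IH.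
rewrite big_ltn; last by lia.
rewrite [RHS]big_ltn// -IH gs_step_nrm// gs_tau_rec; last exact: ltnW.
have := gs_nrm_gt0 (ltnW kc'); have := gs_tau_gt0 kc'.
move=> t0 h0; field; rewrite !gt_eqF//.
Qed.

End Step.

Variable u : nat -> nat -> R.

Fixpoint gs_iter k : nat -> nat -> R :=
  if k is k'.+1 then gs_step (n - k) (gs_iter k') (u ^~ (n - k)%N)
  else fun i r => (i == r)%:R.

(* Vectors obtained once the columns [m, ..., n - 1] of [u] are processed. *)
Definition gs_eta m := gs_iter (n - m).

Lemma gs_etaS c : (c < n)%N -> gs_eta c = gs_step c (gs_eta c.+1) (u ^~ c).
Proof.
move=> cn; rewrite /gs_eta (_ : n - c = (n - c.+1).+1)%N; last by lia.
by rewrite /= (_ : n - (n - c.+1).+1 = c)%N//; lia.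
Qed.

Hypothesis u1 : forall c, (c < n)%N -> u c c = 1.
Hypothesis u0 : forall r c, (c < n)%N -> (c < r)%N -> u r c = 0.

Lemma gs_eta_ind (P : nat -> (nat -> nat -> R) -> Prop) :
  P n (fun i r => (i == r)%:R) ->
  (forall c, (c < n)%N -> P c.+1 (gs_eta c.+1) -> P c (gs_step c (gs_eta c.+1) (u ^~ c))) ->
  forall m, (m <= n)%N -> P m (gs_eta m).
Proof.
move=> P0 PS m mn; rewrite -(subKn mn).
elim: (n - m)%N (leq_subr m n) => [_|k IH kn].
  by rewrite subn0 /gs_eta subnn.
have cn : (n - k.+1 < n)%N by lia.
rewrite gs_etaS//; apply: PS => //.
by rewrite (_ : (n - k.+1).+1 = n - k)%N; [apply: IH; lia|lia].
Qed.

Lemma gs_eta_ortho m : (m <= n)%N -> gs_ortho m (gs_eta m).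
Proof.
move: m; apply: (@gs_eta_ind gs_ortho) => [|c cn oc]; last first.
  by apply: gs_step_ortho => // [|r cr]; rewrite ?u1// u0.
split => [i _|i r _ ri|i j i_n jn ij].
- by rewrite eqxx.
- by rewrite gtn_eqF.
- rewrite (dotE (c := i))//= => [|r _ ri]; first by rewrite [j == i]eq_sym (negbTE ij) mulr0.
  by rewrite eq_sym (negbTE ri) mul0r.
Qed.

(** The Gram--Schmidt vector of column c, orthogonal to all later columns. [gs_pivot c j] is the
    squared distance from column c to the span of the later columns, all truncated to the rows from
    j on. *)
Definition gs_col c := gs_vec c (gs_eta c.+1) (u ^~ c) 0.
Definition gs_pivot c j := gs_tau c (gs_eta c.+1) (u ^~ c) j.

(** Orthogonality to column c and to its Gram--Schmidt vector is created when that column is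
    processed, and survives because later families stay in the span of the earlier ones. *)
Lemma gs_eta_perp m : (m <= n)%N -> forall i c, (i < m)%N -> (m <= c < n)%N ->
  dot (gs_eta m i) (u ^~ c) = 0 /\ dot (gs_eta m i) (gs_col c) = 0.
Proof.
move: m; apply: (@gs_eta_ind (fun m eta => forall i c, (i < m)%N -> (m <= c < n)%N ->
  dot (eta i) (u ^~ c) = 0 /\ dot (eta i) (gs_col c) = 0)) => [i c _|m mn IH i c im].
  by rewrite ltnNge andbC andNb.
have o : gs_ortho m.+1 (gs_eta m.+1) by exact: gs_eta_ortho.
have um r : (m < r)%N -> u r m = 0 by exact: u0.
move=> /andP[]; rewrite leq_eqVlt => /predU1P[<- _|mc cn].
  by split; [apply: gs_step_dot_y|apply: gs_step_dot_vec0] => //; exact: u1.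
by split; apply: gs_step_perp => // j jm; apply IH; rewrite ?ltnS// mc.
Qed.

Lemma gs_pivot_gt0 c j : (c < n)%N -> (j <= c)%N -> 0 < gs_pivot c j.
Proof.
by move=> cn jc; apply: gs_tau_gt0 => // [|//|r cr]; [exact: gs_eta_ortho|exact: u1|exact: u0].
Qed.

Lemma gs_col_u c c' : (c <= c' < n)%N ->
  dot (gs_col c) (u ^~ c') = if c == c' then gs_pivot c 0 else 0.
Proof.
move=> /andP[cc' c'n]; case: eqVneq => [->|ne]; first exact: dot_vec_y.
have lt : (c < c')%N by rewrite ltn_neqAle ne.
rewrite dotC dot_gs_vec big1_seq// => i; rewrite mem_index_iota => /andP[_ /andP[_ ic]].
by rewrite dotC (proj1 (gs_eta_perp _ ic _)) ?mulr0//; lia.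
Qed.

Lemma gs_col_col c c' : (c <= c' < n)%N ->
  dot (gs_col c) (gs_col c') = if c == c' then gs_pivot c 0 else 0.
Proof.
move=> /andP[cc' c'n]; case: eqVneq => [->|ne].
  by apply: dot_vec_vec => //; exact: gs_eta_ortho.
have lt : (c < c')%N by rewrite ltn_neqAle ne.
rewrite dotC dot_gs_vec big1_seq// => i; rewrite mem_index_iota => /andP[_ /andP[_ ic]].
by rewrite dotC (proj2 (gs_eta_perp _ ic _)) ?mulr0//; lia.
Qed.

(* Gram determinant of the columns [m, ..., n - 1] of [u], rows [j, ..., n - 1]. *)
Definition gs_gram j m := \prod_(j <= i < m) gs_nrm (gs_eta m) i.

Lemma gs_gram_gt0 j m : (m <= n)%N -> 0 < gs_gram j m.
Proof.
move=> mn; rewrite /gs_gram big_nat_cond prodr_gt0// => i /andP[/andP[_ im] _].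
case: m mn im => // c cn ic; apply: (@gs_nrm_gt0 c) => //.
exact: gs_eta_ortho.
Qed.

Lemma gs_pivotE c j : (c < n)%N -> (j <= c)%N ->
  gs_pivot c j = gs_gram j c / gs_gram j c.+1.
Proof.
move=> cn jc; apply/(canRL (mulfK _)); first by rewrite gt_eqF// gs_gram_gt0.
rewrite /gs_gram [gs_eta c]gs_etaS//; apply: gs_tau_prod => // [|//|r cr].
- exact: gs_eta_ortho.
- exact: u1.
- exact: u0.
Qed.

Lemma gs_gram_end j : gs_gram j n = 1.
Proof.
rewrite /gs_gram big_nat big1// => i /andP[_ i_n].
rewrite /gs_nrm /gs_eta subnn /= (dotE (c := i))//=; first by rewrite eqxx mulr1.
by move=> r _ ri; rewrite eq_sym (negbTE ri) mul0r.
Qed.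

(** By [gs_pivotE] the product telescopes to [gs_gram i.+1 i.+1 / gs_gram i.+1 n], and both are 1.
    This identity is the source of volume preservation. *)
Lemma gs_pivot_prod i : \prod_(i.+1 <= c < n) gs_pivot c i.+1 = 1.
Proof.
have [in1|?] := ltnP i.+1 n; last by rewrite big_geq.
rewrite (telescope_prodf_eq (fun c => (gs_gram i.+1 c)^-1)) => //.
- by rewrite gs_gram_end invr1 mul1r invrK /gs_gram big_geq.
- by move=> k /andP[_ kn]; rewrite invr_eq0 gt_eqF// gs_gram_gt0// ltnW.
- by move=> c /andP[ic cn]; rewrite gs_pivotE// invrK mulrC.
Qed.

Definition gs_coord i c : R := gs_coef (gs_eta c.+1) (u ^~ c) i.

Lemma gs_nrm_coord i c : (i < c < n)%N -> gs_nrm (gs_eta c) i =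
  gs_nrm (gs_eta c.+1) i + gs_coord i c ^+ 2 / gs_pivot c i.+1.
Proof.
move=> /andP[ic cn]; rewrite gs_etaS// gs_step_nrm// => [|//|r cr].
- exact: gs_eta_ortho.
- exact: u1.
- exact: u0.
Qed.

(** In [gs_nrm_coord] the norm from the previous stage is at least 1, and is replaced by 1; only the
    coordinates of column m are kept, so the bounds for different m involve disjoint sets of
    coordinates. *)
Lemma gs_gram_ge m : (0 < m < n)%N ->
  \prod_(0 <= i < m) (1 + gs_coord i m ^+ 2 / gs_pivot m i.+1) <= gs_gram 0 m.
Proof.
move=> /andP[m0 mn]; rewrite /gs_gram !big_nat; apply: ler_prod => i /andP[_ im].
rewrite gs_nrm_coord ?im//.
have h1 : 1 <= gs_nrm (gs_eta m.+1) i.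
  by apply: (@gs_nrm_ge1 m) => //; [exact: gs_eta_ortho|exact: ltnW].
by rewrite lerD2r h1 andbT addr_ge0// divr_ge0 ?sqr_ge0// ltW// gs_pivot_gt0.
Qed.


(** Only lower entries of column c and entries of later columns enter here; all of them come later
    in the column-by-column numbering. *)
Definition gs_shift i c : R := \sum_(i.+1 <= r < n) gs_eta c.+1 i r * u r c.

Lemma gs_coordE i c : (i <= c < n)%N -> gs_coord i c = u i c + gs_shift i c.
Proof.
move=> /andP[ic cn]; have [e1 e0 _] := gs_eta_ortho cn.
have i_n : (i < n)%N by exact: leq_ltn_trans cn.
rewrite /gs_coord /gs_coef /dot (big_cat_nat (leq0n i.+1))//= big_nat_recr//=.
rewrite big_nat big1 => [|r /andP[_ ri]]; last by rewrite e0 ?ltnS// mul0r.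
by rewrite add0r e1 ?ltnS// mul1r.
Qed.

Lemma gs_coef_agree eta (y y' : nat -> R) i : (i < n)%N ->
  (forall r, (r < i)%N -> eta i r = 0) -> (forall r, (i <= r)%N -> y r = y' r) ->
  gs_coef eta y i = gs_coef eta y' i.
Proof.
move=> i_n e0 yy'; apply: eq_big_nat => r _.
by have [ir|ri] := leqP i r; [rewrite yy'|rewrite e0// !mul0r].
Qed.

End GramSchmidt.

(** * Dependence of pivots and shifts on later entries only *)

Section GramSchmidtDependence.
Variables (R : realFieldType) (n : nat) (u u' : nat -> nat -> R).
Hypothesis u1 : forall c, (c < n)%N -> u c c = 1.
Hypothesis u0 : forall r c, (c < n)%N -> (c < r)%N -> u r c = 0.

Lemma gs_eta_agree m : (m <= n)%N ->
  (forall r c, (m <= c < n)%N -> u r c = u' r c) -> gs_eta n u m = gs_eta n u' m.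
Proof.
move=> mn uu'; rewrite /gs_eta.
have : (n - m <= n - m)%N by [].
elim: {1 3 4}(n - m)%N => [//|k IH km] /=.
rewrite IH 1?ltnW// (_ : u ^~ (n - k.+1)%N = u' ^~ (n - k.+1)%N)//.
by apply/funext => r; apply: uu'; lia.
Qed.

Variables i c : nat.
Hypothesis icn : (i < c < n)%N.
Hypothesis uu' : forall r c', (c < c' < n)%N -> u r c' = u' r c'.
Hypothesis uuc : forall r, (i < r)%N -> u r c = u' r c.

Let eta_agree : gs_eta n u c.+1 = gs_eta n u' c.+1.
Proof. by move/andP: icn => [_ cn]; exact: gs_eta_agree. Qed.

Lemma gs_pivot_agree : gs_pivot n u c i.+1 = gs_pivot n u' c i.+1.
Proof.
move/andP: icn => [ic cn]; have [_ e0 _] := gs_eta_ortho u1 u0 cn.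
rewrite /gs_pivot -eta_agree; apply: eq_big_nat => j /andP[ij jc].
rewrite (@gs_coef_agree _ n _ _ (u' ^~ c))//; first by lia.
- by move=> r rj; exact: e0.
- by move=> r jr; apply: uuc; lia.
Qed.

Lemma gs_shift_agree : gs_shift n u i c = gs_shift n u' i c.
Proof.
by rewrite /gs_shift -eta_agree; apply: eq_big_nat => r /andP[ir _]; rewrite uuc.
Qed.

End GramSchmidtDependence.

(** * Measurability of the Gram--Schmidt quantities *)

Section MeasurableGramSchmidt.
Context d (T : measurableType d) (R : realType).

Lemma measurable_invr (g : T -> R) :
  measurable_fun setT g -> measurable_fun setT (fun x => (g x)^-1).
Proof.
move=> mg; apply: (eq_measurable_fun (fun x => g x * (g x ^+ 2) `^ (-1))).
  move=> x _; have [->|g0] := eqVneq (g x) 0; first by rewrite mul0r invr0.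
  by rewrite powR_inv1 ?sqr_ge0// expr2 invfM mulrA divff// mul1r.
apply: measurable_funM => //.
apply: (measurableT_comp (@measurable_powR R (-1))).
exact: measurable_funX.
Qed.

Variables (n : nat) (u : T -> nat -> nat -> R).
Hypothesis mu : forall r c, measurable_fun setT (fun x => u x r c).

Let measurable_dot (f g : T -> nat -> R) :
  (forall r, measurable_fun setT (f ^~ r)) -> (forall r, measurable_fun setT (g ^~ r)) ->
  measurable_fun setT (fun x => dot n (f x) (g x)).
Proof.
move=> mf mg; apply: (@measurable_sum _ T R setT _ _ (fun r x => f x r * g x r)) => r.
exact: measurable_funM.
Qed.

Let measurable_tau (eta : T -> nat -> nat -> R) (y : T -> nat -> R) c j :
  (forall i r, measurable_fun setT (fun x => eta x i r)) ->
  (forall r, measurable_fun setT (y ^~ r)) ->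
  measurable_fun setT (fun x => gs_tau n c (eta x) (y x) j).
Proof.
move=> me my; apply: measurable_sum => i; apply: measurable_funM.
  by apply: measurable_funX; exact: measurable_dot.
by apply: measurable_invr; exact: measurable_dot.
Qed.

Lemma measurable_gs_eta m i r : measurable_fun setT (fun x => gs_eta n (u x) m i r).
Proof.
rewrite /gs_eta; elim: (n - m)%N i r => [|k IH] i r; first exact: measurable_cst.
rewrite /= /gs_step; apply: measurable_funB => //; apply: measurable_funM.
  apply: measurable_funM; first exact: measurable_dot.
  by apply: measurable_invr; exact: measurable_tau.
apply: measurable_sum => j; apply: measurable_funM => //.
apply: measurable_funM; first exact: measurable_dot.
by apply: measurable_invr; exact: measurable_dot.
Qed.

Lemma measurable_gs_pivot c j : measurable_fun setT (fun x => gs_pivot n (u x) c j).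
Proof. by apply: measurable_tau => // i r; exact: measurable_gs_eta. Qed.

Lemma measurable_gs_shift i c : measurable_fun setT (fun x => gs_shift n (u x) i c).
Proof.
apply: measurable_sum => r; apply: measurable_funM => //.
exact: measurable_gs_eta.
Qed.

End MeasurableGramSchmidt.

(** * Coordinates on the unipotent group *)

(* Inverse of [(i, c) |-> 'C(c, 2) + i], for i < c. *)
Fixpoint upper_index k : nat * nat :=
  if k is k'.+1 then
    let: (i, c) := upper_index k' in
    if (i.+1 < c)%N then (i.+1, c) else (0%N, c.+1)
  else (0%N, 1%N).

Lemma upper_indexP k : ((upper_index k).1 < (upper_index k).2)%N /\
  k = ('C((upper_index k).2, 2) + (upper_index k).1)%N.
Proof.
elim: k => [//|k /=]; case: (upper_index k) => i c /= [ic kE].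
case: ifPn => [|]; first by rewrite kE addnS.
rewrite -leqNgt => ci; have {ci ic} ci : c = i.+1 by lia.
by subst c; rewrite /= binS bin1 kE; lia.
Qed.

Lemma bin2_row_lt i c c' : (i < c)%N -> (c < c')%N -> ('C(c, 2) + i < 'C(c', 2))%N.
Proof.
move=> ic cc'; apply: (@leq_trans 'C(c.+1, 2)); last exact: leq_bin2l.
by rewrite binS bin1; lia.
Qed.

Lemma upper_indexK i c : (i < c)%N -> upper_index ('C(c, 2) + i) = (i, c).
Proof.
move=> ic; have [] := upper_indexP ('C(c, 2) + i).
case: (upper_index _) => j e /= je E.
have [ce|ec|] := ltngtP c e.
- by have := bin2_row_lt ic ce; lia.
- by have := bin2_row_lt je ec; lia.
- by move=> ce; subst e; congr pair; lia.
Qed.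

Lemma upper_index_lt n k : (k < 'C(n, 2))%N -> ((upper_index k).2 < n)%N.
Proof.
move=> kn; have [_ kE] := upper_indexP k.
rewrite ltnNge; apply/negP => /(leq_bin2l 2); lia.
Qed.

Lemma prod_upper_index (R : comSemiRingType) n (g : nat -> nat -> R) :
  \prod_(k < 'C(n, 2)) g (upper_index k).1 (upper_index k).2 =
  \prod_(0 <= c < n) \prod_(0 <= i < c) g i c.
Proof.
rewrite -(big_mkord xpredT (fun k => g (upper_index k).1 (upper_index k).2)).
elim: n => [|n IH]; first by rewrite !big_geq.
rewrite big_nat_recr//= -IH binS bin1 (big_cat_nat (n := 'C(n, 2)))//=; last by lia.
congr (_ * _); rewrite -{1}(add0n (binomial n 2)) big_addn addKn.
apply: eq_big_nat => i /andP[_ i_n].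
by rewrite addnC upper_indexK.
Qed.

Section UnipotentCoordinates.
Variables (R : realType) (n : nat).
Local Notation RT := (measurableTypeR R).
Local Notation N := 'C(n, 2).

Definition unip_entry (t : N.-tuple RT) (r c : nat) : R :=
  if (r < c)%N then nth 0 t ('C(c, 2) + r) else (r == c)%:R.

Lemma unip_entry_diag t c : unip_entry t c c = 1.
Proof. by rewrite /unip_entry ltnn eqxx. Qed.

Lemma unip_entry_low t r c : (c < r)%N -> unip_entry t r c = 0.
Proof. by move=> cr; rewrite /unip_entry ltnNge ltnW//= gtn_eqF. Qed.

Lemma unip_mxE t (i j : 'I_n) : unip_mx t i j = unip_entry t i j.
Proof. by rewrite mxE. Qed.

Lemma unip_entry_upper (t : N.-tuple RT) (k : 'I_N) :
  unip_entry t (upper_index k).1 (upper_index k).2 = tnth t k.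
Proof.
have [ic kE] := upper_indexP k.
by rewrite /unip_entry ic -kE (tnth_nth 0).
Qed.

Lemma measurable_unip_entry r c :
  measurable_fun setT (fun t : N.-tuple RT => unip_entry t r c).
Proof.
rewrite /unip_entry; case: (r < c)%N; last exact: measurable_cst.
have [lt|ge] := ltnP ('C(c, 2) + r) N; last first.
  by under eq_fun do rewrite nth_default ?size_tuple//; exact: measurable_cst.
apply: (eq_measurable_fun (@tnth N RT ^~ (Ordinal lt))); last exact: measurable_tnth.
by move=> t _; rewrite (tnth_nth 0).
Qed.

Lemma unip_entry_agree (k : 'I_N) (t t' : N.-tuple RT) :
  (forall m : 'I_N, (k < m)%N -> tnth t m = tnth t' m) ->
  (forall r c, ((upper_index k).2 < c < n)%N -> unip_entry t r c = unip_entry t' r c) /\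
  (forall r, ((upper_index k).1 < r)%N ->
    unip_entry t r (upper_index k).2 = unip_entry t' r (upper_index k).2).
Proof.
move=> tt'; have [ic kE] := upper_indexP k.
have cn := upper_index_lt (ltn_ord k).
have tE m : (k < m)%N -> (m < N)%N -> nth 0 t m = nth 0 t' m.
  by move=> km mN; have := tt' (Ordinal mN) km; rewrite !(tnth_nth 0).
split=> [r c /andP[kc c_n]|r kr]; rewrite /unip_entry; case: ifP => // rc; apply: tE.
- by rewrite kE; have := bin2_row_lt ic kc; lia.
- exact: bin2_row_lt.
- by rewrite {1}kE; lia.
- exact: bin2_row_lt.
Qed.

(** With this normalisation the increment of the squared norm in [gs_nrm_coord] is exactly the
    square of the new coordinate, as [gs_mapE] records. *)
Definition gs_scale (k : 'I_N) (t : N.-tuple RT) : R :=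
  (Num.sqrt (gs_pivot n (unip_entry t) (upper_index k).2 (upper_index k).1.+1))^-1.

Definition gs_offset (k : 'I_N) (t : N.-tuple RT) : R :=
  gs_scale k t * gs_shift n (unip_entry t) (upper_index k).1 (upper_index k).2.

Definition gs_map := triangular_map gs_scale gs_offset.

Lemma gs_scale_gt0 k t : 0 < gs_scale k t.
Proof.
have [ic _] := upper_indexP k; have cn := upper_index_lt (ltn_ord k).
rewrite invr_gt0 sqrtr_gt0 gs_pivot_gt0// => c; first by rewrite unip_entry_diag.
by move=> r cc; exact: unip_entry_low.
Qed.

(** Taken row by row instead of column by column, the product splits into the products of
    [gs_pivot_prod], each equal to 1. *)
Lemma prod_gs_scale t : \prod_(k < N) gs_scale k t = 1.
Proof.
set u := unip_entry t.
have u1 c : (c < n)%N -> u c c = 1 by rewrite /u unip_entry_diag.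
have u0 r c : (c < n)%N -> (c < r)%N -> u r c = 0 by move=> _; exact: unip_entry_low.
have P0 : 0 <= \prod_(k < N) gs_scale k t.
  by apply: prodr_ge0 => k _; exact/ltW/gs_scale_gt0.
(* Both sides are nonnegative; squaring removes the square roots. *)
apply/eqP; rewrite -(eqrXn2 (n := 2))// expr1n -prodrXl.
rewrite (eq_bigr (fun k : 'I_N =>
  (fun i c => (gs_pivot n u c i.+1)^-1) (upper_index k).1 (upper_index k).2)); last first.
  move=> k _; have [ic _] := upper_indexP k; have cn := upper_index_lt (ltn_ord k).
  by rewrite exprVn sqr_sqrtr// ltW// gs_pivot_gt0.
rewrite (prod_upper_index n (fun i c => (gs_pivot n u c i.+1)^-1)).
under eq_big_nat => c /andP[_ /ltnW cn] do rewrite (big_nat_widen 0 c n)//.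
rewrite (exchange_big_dep_nat xpredT)//= big_nat big1// => i /andP[_ i_n].
transitivity (\prod_(i.+1 <= c < n) gs_pivot n u c i.+1)^-1.
  by rewrite -prodfV [RHS](big_nat_widenl _ 0).
by rewrite gs_pivot_prod ?invr1.
Qed.

Lemma measurable_gs_scale k : measurable_fun setT (gs_scale k).
Proof.
apply: measurable_invr; apply: (measurableT_comp (continuous_measurable_fun (@sqrt_continuous R))).
by apply: measurable_gs_pivot => r c; exact: measurable_unip_entry.
Qed.

Lemma measurable_gs_offset k : measurable_fun setT (gs_offset k).
Proof.
apply: measurable_funM; first exact: measurable_gs_scale.
by apply: measurable_gs_shift => r c; exact: measurable_unip_entry.
Qed.

Lemma measurable_gs_map : measurable_fun setT gs_map.
Proof.
by apply: measurable_triangular_map => k;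
  [exact: measurable_gs_scale|exact: measurable_gs_offset].
Qed.

Lemma gs_scale_depends k : depends_after k (gs_scale k).
Proof.
move=> t t' /unip_entry_agree[tc tr]; have [ic _] := upper_indexP k.
have cn := upper_index_lt (ltn_ord k).
rewrite /gs_scale (@gs_pivot_agree _ n _ (unip_entry t'))//; last by rewrite ic.
- by move=> c _; exact: unip_entry_diag.
- by move=> r c _; exact: unip_entry_low.
Qed.

Lemma gs_offset_depends k : depends_after k (gs_offset k).
Proof.
move=> t t' tt'; rewrite /gs_offset (gs_scale_depends tt').
have [tc tr] := unip_entry_agree tt'; have [ic _] := upper_indexP k.
have cn := upper_index_lt (ltn_ord k).
by rewrite (@gs_shift_agree _ n _ (unip_entry t'))// ic.
Qed.

Lemma ge0_integral_gs_map (F : N.-tuple RT -> \bar R) :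
  measurable_fun setT F -> (forall t, 0 <= F t)%E ->
  (\int[@lebesgue_tuple R N]_t F (gs_map t) = \int[@lebesgue_tuple R N]_t F t)%E.
Proof.
move=> mF F0; rewrite -(ge0_integral_triangular_map measurable_gs_scale
  measurable_gs_offset gs_scale_depends gs_offset_depends gs_scale_gt0 mF F0).
by apply: eq_integral => t _; rewrite prod_gs_scale mule1.
Qed.

Lemma gs_mapE (k : 'I_N) t :
  tnth (gs_map t) k ^+ 2 =
  gs_coord n (unip_entry t) (upper_index k).1 (upper_index k).2 ^+ 2 /
  gs_pivot n (unip_entry t) (upper_index k).2 (upper_index k).1.+1.
Proof.
have [ic _] := upper_indexP k; have cn := upper_index_lt (ltn_ord k).
set i := (upper_index k).1 in ic *; set c := (upper_index k).2 in ic cn *.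
have -> : tnth (gs_map t) k = gs_scale k t * gs_coord n (unip_entry t) i c.
  have -> : tnth (gs_map t) k = gs_scale k t * tnth t k + gs_offset k t.
    exact: tnth_mktuple.
  rewrite /gs_offset -/i -/c.
  rewrite (@gs_coordE _ _ (unip_entry t)).
  - rewrite mulrDr. by rewrite (unip_entry_upper t k).
  - by move=> d _; exact: unip_entry_diag.
  - by move=> r d _; exact: unip_entry_low.
  - by rewrite ltnW.
rewrite exprMn mulrC; congr (_ * _).
rewrite /gs_scale -/i -/c exprVn. rewrite sqr_sqrtr// ltW//.
rewrite gs_pivot_gt0//.
- by move=> d _; exact: unip_entry_diag.
- by move=> r d _; exact: unip_entry_low.
Qed.

End UnipotentCoordinates.

(** * Convergence of the Harish-Chandra integral *)

Section Decay.
Variables (R : realType) (eps : R).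
Hypothesis eps0 : 0 < eps.
Local Notation RT := (measurableTypeR R).

(** This is (1 + x^2)^(-(1 + eps) / 2), of order |x|^(-(1 + eps)) at infinity. *)
Definition decay (x : R) : R := expR (- ((1 + eps) / 2) * ln (1 + x ^+ 2)).

Lemma decay_ge0 x : 0 <= decay x. Proof. exact: expR_ge0. Qed.

Let sqr1_gt0 (x : R) : 0 < 1 + x ^+ 2.
Proof. by rewrite ltr_wpDr// sqr_ge0. Qed.

Lemma continuous_decay : continuous decay.
Proof.
move=> x; apply: continuous_comp; last exact: continuous_expR.
apply: continuousM; first exact: cvg_cst.
apply: continuous_comp.
  by apply: continuousD; [exact: cvg_cst|exact: exprn_continuous].
by apply: continuous_ln; exact: sqr1_gt0.
Qed.

Lemma measurable_decay : measurable_fun setT decay.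
Proof. by apply: continuous_measurable_fun; exact: continuous_decay. Qed.

(** Comes from (1 + x)^2 <= 2 (1 + x^2); the right-hand side has an elementary antiderivative. *)
Lemma decay_le (x : R) : 0 <= x ->
  decay x <= expR ((1 + eps) / 2 * ln 2) * (1 + x) `^ (- (1 + eps)).
Proof.
move=> x0; rewrite /powR gt_eqF ?ltr_wpDr// /decay -expRD ler_expR.
have -> : (1 + eps) / 2 * ln 2 + - (1 + eps) * ln (1 + x) =
   - ((1 + eps) / 2) * (ln ((1 + x) ^+ 2) - ln 2).
  by rewrite lnXn ?ltr_wpDr//; field.
rewrite ler_nM2l; last by rewrite oppr_lt0 divr_gt0// addr_gt0.
rewrite lerBlDr -lnM ?posrE ?sqr1_gt0//.
rewrite ler_ln ?posrE ?mulr_gt0 ?exprn_gt0 ?sqr1_gt0 ?ltr_wpDr//.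
by have := sqr_ge0 (1 - x); nra.
Qed.

Lemma integral_decay_lty : (\int[@lebesgue_measure R]_x (decay x)%:E < +oo)%E.
Proof.
rewrite ge0_symfun_integralT; [|exact: decay_ge0|exact: continuous_decay|]; last first.
  by move=> x; rewrite /decay /= sqrrN.
apply: lte_mul_pinfty => //.
rewrite (_ : [set x | 0 <= x] = `[0, +oo[%classic); last first.
  by apply/seteqP; split=> x /=; rewrite in_itv/= andbT.
set C := expR ((1 + eps) / 2 * ln 2).
apply: (@le_lt_trans _ _ (\int[@lebesgue_measure R]_(x in `[0%R, +oo[)
    (C * (1 + x) `^ (- (1 + eps)))%R%:E)%E).
  apply: ge0_le_integral => //=.
  - by move=> x _; rewrite lee_fin decay_ge0.
  - apply/measurable_EFinP; apply: measurable_funTS; exact: measurable_decay.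
  - apply/measurable_EFinP; apply: measurable_funTS.
    apply: measurable_funM => //.
    by apply: (measurableT_comp (@measurable_powR R (- (1 + eps)))); exact: measurable_funD.
  - by move=> x; rewrite /= in_itv/= andbT => x0; rewrite lee_fin decay_le.
(* The antiderivative of the majorant that vanishes at infinity. *)
pose F (x : R) : R := - (C / eps) * (1 + x) `^ (- eps).
have C0 : 0 <= C by exact: expR_ge0.
have dP (a x : R) : 0 <= x ->
    is_derive x 1 (fun z : R => (1 + z) `^ a) (a * (1 + x) `^ (a - 1)).
  move=> x0; have x1 : 0 < 1 + x by rewrite ltr_wpDr.
  have d1 : is_derive x 1 (fun z : R => 1 + z) 1.
    by rewrite -[X in is_derive _ _ _ X]add0r; exact: is_deriveD.
  have := @is_derive1_comp _ (@powR R ^~ a) _ x _ _ (is_derive1_powR a x1) d1.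
  by rewrite mulr1.
have cP (a x : R) : 0 <= x -> {for x, continuous (fun z : R => (1 + z) `^ a : R)}.
  by move=> /(dP a)[/derivable1_diffP/differentiable_continuous].
have dF (x : R) : 0 <= x -> is_derive x 1 F (C * (1 + x) `^ (- (1 + eps))).
  move=> x0; have -> : C * (1 + x) `^ (- (1 + eps)) =
      - (C / eps) * ((- eps) * (1 + x) `^ (- eps - 1)).
    by rewrite (_ : - (1 + eps) = - eps - 1); [field; rewrite gt_eqF|ring].
  exact: (is_deriveZ (- (C / eps)) (dP (- eps) x x0)).
suff -> : (\int[@lebesgue_measure R]_(x in `[0%R, +oo[)
    (C * (1 + x) `^ (- (1 + eps)))%R%:E = 0%R%:E - (F 0)%:E)%E by rewrite ltry.
apply: ge0_continuous_FTC2y.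
- by move=> x _; rewrite mulr_ge0// powR_ge0.
- apply: continuous_in_subspaceT => x; rewrite inE/= in_itv/= andbT => x0.
  have cf : {for x, continuous (fun z : R => C * (1 + z) `^ (- (1 + eps)) : R)}.
    by apply: continuousM; [exact: cvg_cst|exact: cP].
  exact: cf.
- rewrite -(mulr0 (- (C / eps))); apply: cvgM; first exact: cvg_cst.
  apply: (@cvg_trans _ ((expR \o -%R) (eps * ln (1 + x)) @[x --> +oo])).
    apply: near_eq_cvg; near=> x.
    rewrite /= /powR gt_eqF ?mulNr//.
    by rewrite ltr_wpDr//; near: x; exact: nbhs_pinfty_ge.
  apply: (cvg_comp (fun x => eps * ln (1 + x)) (expR \o -%R) _ (@cvgr_expR R)).
  apply/cvgryPge => A; near=> x.
  rewrite -ler_pdivrMl// -ler_expR lnK ?posrE.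
    apply: (@le_trans _ _ x); last by rewrite lerDr.
    by near: x; apply: nbhs_pinfty_ge; rewrite num_real.
  by rewrite ltr_wpDr//; near: x; exact: nbhs_pinfty_ge.
- by move=> x /ltW /dF[].
- apply: cvg_at_right_filter.
  by have [/derivable1_diffP/differentiable_continuous] := dF 0 (lexx 0).
- move=> x; rewrite in_itv/= andbT => /ltW /dF d.
  by rewrite derive1E derive_val.
Unshelve. all: by end_near. Qed.

Lemma integral_prod_decay_lty N :
  (\int[@lebesgue_tuple R N]_t (\prod_(k < N) decay (tnth t k))%:E < +oo)%E.
Proof.
have mprod M : measurable_fun setT (fun t : M.-tuple RT => \prod_(k < M) decay (tnth t k)).
  apply: measurable_prod => k _; apply: measurableT_comp; first exact: measurable_decay.
  exact: measurable_tnth.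
have prod0 M (t : M.-tuple RT) : 0 <= \prod_(k < M) decay (tnth t k).
  by apply: prodr_ge0 => k _; exact: decay_ge0.
elim: N => [|N IH].
  under eq_integral do rewrite big_ord0.
  by rewrite integral_cst//= diracT mul1e ltry.
rewrite (proj2 (@ge0_integral_tcons R N _ _ _)); first last.
- by move=> t; rewrite lee_fin.
- by apply/measurable_EFinP; exact: mprod.
have E (t : N.-tuple RT) : (\int[@lebesgue_measure R]_x
    (\prod_(k < N.+1) decay (tnth (tcons (x, t)) k))%:E =
    (\prod_(k < N) decay (tnth t k))%:E * \int[@lebesgue_measure R]_x (decay x)%:E)%E.
  rewrite -ge0_integralZl//=.
  - apply: eq_integral => x _; rewrite -EFinM big_ord_recl mulrC tnth0.
    by congr (_ * _)%:E; apply: eq_bigr => k _; rewrite tnthS.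
  - by apply/measurable_EFinP; exact: measurable_decay.
  - by move=> x _; rewrite lee_fin decay_ge0.
  - by rewrite lee_fin; exact: prod0.
under eq_integral do rewrite E.
rewrite ge0_integralZr//=.
- apply: lte_mul_pinfty => //; last exact: integral_decay_lty.
    by apply: integral_ge0 => t _; rewrite lee_fin; exact: prod0.
  by rewrite ge0_fin_numE//; apply: integral_ge0 => t _; rewrite lee_fin; exact: prod0.
- by apply/measurable_EFinP; exact: mprod.
- by move=> t _; rewrite lee_fin; exact: prod0.
- by apply: integral_ge0 => x _; rewrite lee_fin decay_ge0.
Qed.

End Decay.

(** * Lower triangular Iwasawa decomposition and bound on its torus part *)

Section Iwasawa.
Variables (R : realType) (n : nat).
Local Notation RT := (measurableTypeR R).
Local Notation N := 'C(n, 2).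
Variable t : N.-tuple RT.
Local Notation u := (unip_entry t).
Local Notation pivot c := (gs_pivot n u c 0).

Let u1 c : (c < n)%N -> u c c = 1. Proof. by rewrite unip_entry_diag. Qed.
Let u0 r c : (c < n)%N -> (c < r)%N -> u r c = 0.
Proof. by move=> _; exact: unip_entry_low. Qed.

Definition gs_torus : 'M[R]_n := diag_mx (\row_c Num.sqrt (pivot c)).

Lemma torusA_gs_torus : torusA gs_torus.
Proof.
split=> [|i]; first exact: diag_mx_is_diag.
by rewrite !mxE eqxx mulr1n sqrtr_gt0 gs_pivot_gt0.
Qed.

(** The columns of [kappa] are the normalised Gram--Schmidt vectors. As [gs_col i] is orthogonal to
    every later column, the product of the transpose of [kappa] with [unip_mx t] is lower
    triangular, with the square roots of the pivots on its diagonal. *)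
Lemma unip_iwasawa : exists kappa ubar : 'M[R]_n,
  [/\ orthoK kappa, unipUbar ubar & unip_mx t = kappa *m gs_torus *m ubar].
Proof.
have pgt0 (c : 'I_n) : 0 < Num.sqrt (pivot c).
  by rewrite sqrtr_gt0 gs_pivot_gt0.
have pE (c : 'I_n) : pivot c = Num.sqrt (pivot c) * Num.sqrt (pivot c).
  by rewrite -expr2 sqr_sqrtr// ltW// gs_pivot_gt0.
pose kappa : 'M[R]_n := \matrix_(r, c) (gs_col n u c r / Num.sqrt (pivot c)).
have kk : kappa^T *m kappa = 1%:M.
  apply/matrixP => i j; rewrite !mxE.
  transitivity (dot n (gs_col n u i) (gs_col n u j) /
      (Num.sqrt (pivot i) * Num.sqrt (pivot j))).
    rewrite /dot big_mkord mulr_suml; apply: eq_bigr => r _.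
    by rewrite !mxE; field; rewrite !gt_eqF.
  wlog ij : i j / (i <= j)%N.
    move=> W; have [/W//|/ltnW/W] := leqP i j.
    by rewrite dotC mulrC eq_sym => <-; rewrite [in RHS]mulrC [in LHS](mulrC (Num.sqrt _)).
  rewrite gs_col_col ?ij//= val_eqE; case: eqVneq => [->|_]; last by rewrite mul0r.
  by rewrite -pE divff// gt_eqF// gs_pivot_gt0.
have kK : orthoK kappa by exact: mulmx1C.
pose b : 'M[R]_n := kappa^T *m unip_mx t.
have bE i j : b i j = dot n (gs_col n u i) (u ^~ j) / Num.sqrt (pivot i).
  rewrite !mxE /dot big_mkord mulr_suml; apply: eq_bigr => r _.
  by rewrite !mxE mulrAC.
exists kappa, (\matrix_(i, j) (b i j / Num.sqrt (pivot i))); split => //.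
  split=> [i|i j ij]; rewrite mxE bE.
    rewrite gs_col_u//; last by rewrite leqnn ltn_ord.
    by rewrite eqxx {1}pE; field; rewrite gt_eqF.
  rewrite gs_col_u//; last by rewrite (ltnW ij) ltn_ord.
  by rewrite (ltn_eqF ij) !mul0r.
rewrite -mulmxA -[LHS]mul1mx -kK -mulmxA; congr (_ *m _).
apply/matrixP => i j; rewrite mul_diag_mx !mxE mulrC divfK ?gt_eqF//.
Qed.

(** Applied with L the logarithm of a Gram determinant, which is 0 at both ends, so that only the
    increments of r survive. *)
Lemma sum_by_parts (r L : nat -> R) m :
  \sum_(0 <= c < m.+1) r c * (L c - L c.+1) =
  r 0%N * L 0%N - r m * L m.+1 + \sum_(0 <= c < m) (r c.+1 - r c) * L c.+1.
Proof.
elim: m => [|m IH]; first by rewrite big_nat1 big_geq//; ring.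
by rewrite big_nat_recr//= IH big_nat_recr//=; ring.
Qed.

(** Each ln of a torus entry is half a difference of logarithms of Gram determinants. After
    summation by parts the increments of r, at most -(1 + eps), multiply these nonnegative
    logarithms, which [gs_gram_ge] bounds below by the coordinates. *)
Lemma gs_torus_bound (eps : R) (r : nat -> R) : 0 <= eps ->
  (forall c, (c.+1 < n)%N -> r c.+1 - r c <= - (1 + eps)) ->
  expR (\sum_(0 <= c < n) r c * ln (Num.sqrt (pivot c))) <=
  \prod_(k < N) decay eps (tnth (gs_map t) k).
Proof.
move=> eps0 rc.
pose q i c : R := decay eps (gs_coord n u i c / Num.sqrt (gs_pivot n u c i.+1)).
have qE i c : (i < c < n)%N -> q i c = expR (- ((1 + eps) / 2) *
    ln (1 + gs_coord n u i c ^+ 2 / gs_pivot n u c i.+1)).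
  by move=> /andP[ic cn]; rewrite /q /decay exprMn exprVn sqr_sqrtr// ltW// gs_pivot_gt0.
rewrite [leRHS](_ : _ = \prod_(k < N) q (upper_index k).1 (upper_index k).2); last first.
  apply: eq_bigr => k _; have [ic _] := upper_indexP k.
  have cn := upper_index_lt (ltn_ord k).
  by rewrite qE ?ic// /decay gs_mapE.
rewrite prod_upper_index.
pose L c : R := ln (gs_gram n u 0 c).
have lnp c : (c < n)%N -> ln (Num.sqrt (pivot c)) = 2^-1 * (L c - L c.+1).
  move=> cn; have p0 : 0 < pivot c by rewrite gs_pivot_gt0.
  have -> : L c - L c.+1 = ln (pivot c).
    by rewrite gs_pivotE// ln_div// posrE gs_gram_gt0// ltnW.
  by rewrite -{2}[pivot c]sqr_sqrtr ?ltW// lnXn ?sqrtr_gt0//; field.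
rewrite (eq_big_nat _ _ (F2 := fun c => 2^-1 * (r c * (L c - L c.+1)))); last first.
  by move=> c /andP[_ cn]; rewrite lnp// mulrCA.
rewrite -mulr_sumr; case: (posnP n) => [n0|n_gt0].
  by rewrite n0 !big_geq// mulr0 expR0.
rewrite (_ : index_iota 0 n = index_iota 0 n.-1.+1); last by rewrite prednK.
rewrite sum_by_parts prednK//.
have -> : L 0%N = 0 by rewrite /L /gs_gram big_geq// ln1.
have -> : L n = 0 by rewrite /L gs_gram_end ln1.
(* Column 0 has no entry above the diagonal; summand c is compared with the factors of column c +
   1. *)
rewrite !mulr0 subr0 add0r [leRHS]big_ltn// [\prod_(0 <= i < 0) _]big_geq// mul1r.
rewrite [leRHS]big_add1 mulr_sumr expR_sum.
rewrite !big_nat; apply: ler_prod => c /andP[_ cn1].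
have cn : (c.+1 < n)%N by rewrite -ltn_predRL.
rewrite expR_ge0/=.
have prod_exp (x : nat -> R) m : (forall i, (i < m)%N -> 0 < x i) ->
    \prod_(0 <= i < m) expR (- ((1 + eps) / 2) * ln (x i)) =
    expR (- ((1 + eps) / 2) * ln (\prod_(0 <= i < m) x i)).
  elim: m => [_|m IH x0]; first by rewrite !big_geq// ln1 mulr0 expR0.
  rewrite !big_nat_recr//= IH => [|i im]; last by apply: x0; exact: ltnW.
  rewrite -expRD -mulrDr lnM// posrE; last exact: x0.
  by rewrite big_nat prodr_gt0// => i /andP[_ im]; apply: x0; exact: ltnW.
have z0 i : (i < c.+1)%N -> 0 <= gs_coord n u i c.+1 ^+ 2 / gs_pivot n u c.+1 i.+1.
  by move=> ic; rewrite divr_ge0 ?sqr_ge0// ltW// gs_pivot_gt0.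
rewrite (eq_big_nat _ _ (F2 := fun i => expR (- ((1 + eps) / 2) *
    ln (1 + gs_coord n u i c.+1 ^+ 2 / gs_pivot n u c.+1 i.+1)))); last first.
  by move=> i /andP[_ ic]; apply: qE; rewrite ic.
rewrite prod_exp => [|i ic]; last by rewrite ltr_pwDl// z0.
rewrite ler_expR.
set P := \prod_(0 <= i < c.+1) _.
have P1 : 1 <= P.
  rewrite /P big_nat; apply: (big_ind (fun x : R => 1 <= x)) => // [x y x1 y1|i /andP[_ ic]].
    by rewrite -[1]mulr1 ler_pM.
  by rewrite lerDl z0.
have PL : ln P <= L c.+1.
  rewrite ler_ln ?posrE; first by apply: gs_gram_ge.
    exact: lt_le_trans P1.
  by rewrite gs_gram_gt0// ltnW.
have lnP0 : 0 <= ln P by exact: ln_ge0.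
have := rc c cn; nra.
Qed.

End Iwasawa.

(** * Matrices: topology and measurability *)

Section MatrixTopology.
Variable R : realType.

Lemma cvg_mx (T : Type) (F : set_system T) (FF : Filter F) m n
    (M : T -> 'M[R]_(m, n)) (A : 'M[R]_(m, n)) :
  (forall i j, M x i j @[x --> F] --> A i j) -> M @ F --> A.
Proof.
move=> MA P [Q AQ QP]; rewrite /nbhs/=.
apply: (@filterS _ _ _ [set x | forall i j, Q i j (M x i j)]) => [x Qx|].
  exact: QP.
by apply: filter_forall => i; apply: filter_forall => j; exact: MA (AQ i j).
Qed.

Lemma continuous_det n : continuous (fun A : 'M[R]_n => \det A : R).
Proof.
apply: (@continuous_big R _ +%R 0 xpredT (@add_continuous R) _ _
  (fun (s : {perm 'I_n}) (A : 'M[R]_n) => (-1) ^+ s * \prod_i A i (s i))) => s _ A.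
apply: (@continuousM R _ (fun=> (-1) ^+ s) (fun A : 'M[R]_n => \prod_i A i (s i))).
  exact: cst_continuous.
move: A.
apply: (@continuous_big R _ *%R 1 xpredT (@mul_continuous R) _ _
  (fun (i : 'I_n) (A : 'M[R]_n) => A i (s i))) => i _.
exact: coord_continuous.
Qed.

Lemma open_GL n : open (@GL R n).
Proof.
rewrite (_ : @GL R n = (fun A : 'M[R]_n => \det A : R) @^-1` [set x | x != 0]).
  by apply: open_comp => [A _|]; [exact: continuous_det|exact: open_neq].
by apply/seteqP; split=> A; rewrite /GL/= unitmxE unitfE.
Qed.

End MatrixTopology.

(** * Measurability of continuous functions of several variables *)

Section MeasurableContinuous.
Variables (R : realType) (N : nat).
Local Notation RT := (measurableTypeR R).

Let grid (m : nat) (z : N.-tuple int) : N.-tuple RT :=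
  [tuple ((tnth z k)%:~R / m.+1%:R)%R | k < N].
Let cell (m : nat) (t : N.-tuple RT) : N.-tuple int :=
  [tuple Num.floor (m.+1%:R * tnth t k)%R | k < N].

Let measurable_cell m z : measurable [set t | cell m t = z].
Proof.
rewrite (_ : [set t | _] = \bigcap_(k in [set: 'I_N])
    (tnth (T := RT) ^~ k @^-1` [set x | m.+1%:R^-1 * (tnth z k)%:~R <= x
       < m.+1%:R^-1 * (tnth z k + 1)%:~R])).
  apply: fin_bigcap_measurable => // k _.
  rewrite -[X in measurable X]setTI; apply: measurable_tnth => //.
  rewrite (_ : [set x | _] = `[m.+1%:R^-1 * (tnth z k)%:~R,
     m.+1%:R^-1 * (tnth z k + 1)%:~R[%classic) //.
have m0 : (0 : R) < m.+1%:R by rewrite ltr0n.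
apply/seteqP; split=> t /=.
  move=> <- k _ /=; rewrite tnth_mktuple ler_pdivrMl// ltr_pdivlMl//.
  by rewrite ge_floor// lt_succ_floor.
move=> H; apply: eq_from_tnth => k; rewrite tnth_mktuple.
by apply: floor_def; have := H k I; rewrite /= ler_pdivrMl// ltr_pdivlMl.
Qed.

(* Approximate [F] by step functions over the cells of the lattice Z^N / m. *)
Lemma measurable_seq_continuous (F : N.-tuple RT -> R) :
  (forall t (s : nat -> N.-tuple RT),
    (forall k, tnth (s m) k @[m --> \oo] --> (tnth t k : R)) ->
    F (s m) @[m --> \oo] --> F t) ->
  measurable_fun setT F.
Proof.
move=> cF; apply: (@measurable_fun_cvg _ _ _ _ (fun m t => F (grid m (cell m t)))).
  move=> m _ Y mY; rewrite setTI.
  rewrite (_ : _ @^-1` Y = \bigcup_z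
     (if pselect (Y (F (grid m z))) then [set t | cell m t = z] else set0)).
    apply: countable_bigcupT_measurable => [|z]; first exact: countableP.
    by case: pselect => ?; [exact: measurable_cell|exact: measurable0].
  apply/seteqP; split=> t /=.
    by move=> Yt; exists (cell m t) => //; case: pselect.
  by move=> [z _]; case: pselect => //= Yz ->.
move=> t _; apply: cF => k.
rewrite /=.
(* Rounding down to the lattice of mesh 1 / (m + 1) moves a coordinate by at most [harmonic m]. *)
apply: (@squeeze_cvgr _ _ _ _ (fun m => tnth t k - harmonic m) (fun=> tnth t k)).
- near=> m; rewrite !tnth_mktuple /harmonic.
  have m0 : (0 : R) < m.+1%:R by rewrite ltr0n.
  rewrite ler_pdivrMr// ler_pdivlMr// mulrBl mulVf ?gt_eqF// mulrC.
  have := floor_itv (m.+1%:R * tnth t k : R) => /andP[-> +].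
  by rewrite intrD andbT lerBlDr => /ltW.
- by rewrite -[X in _ --> X]subr0; apply: cvgB; [exact: cvg_cst|exact: cvg_harmonic].
- exact: cvg_cst.
Unshelve. all: by end_near. Qed.

End MeasurableContinuous.

Section UnipotentMatrix.
Variables (R : realType) (n : nat).
Local Notation RT := (measurableTypeR R).
Local Notation N := 'C(n, 2).

Lemma det_unip_mx (t : N.-tuple RT) : \det (unip_mx t) = 1.
Proof.
rewrite -det_tr det_trig; last first.
  apply/is_trig_mxP => i j ij; rewrite mxE unip_mxE unip_entry_low//.
by rewrite big1// => i _; rewrite mxE unip_mxE unip_entry_diag.
Qed.

Lemma unip_mx_unit (t : N.-tuple RT) : unip_mx t \in unitmx.
Proof. by rewrite unitmxE det_unip_mx unitr1. Qed.

Lemma measurable_unip_mx (h : 'M[R]_n -> R) (p : 'M[R]_n) : p \in unitmx ->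
  (forall x, GL x -> {for x, continuous h}) ->
  measurable_fun setT (fun t : N.-tuple RT => h (p *m unip_mx t)).
Proof.
move=> pu ch; apply: measurable_seq_continuous => t s st.
have GLt : GL (p *m unip_mx t) by rewrite /GL/= unitmx_mul pu unip_mx_unit.
apply: (@continuous_cvg _ _ _ _ _ (fun m => p *m unip_mx (s m)) h _ (ch _ GLt)).
apply: cvg_mx => i j; rewrite mxE.
rewrite (_ : (fun m => _) = (fun m => \sum_r p i r * unip_mx (s m) r j)); last first.
  by apply/funext => m; rewrite mxE.
apply: (@cvg_big R _ +%R 0 xpredT (@add_continuous R) _ _ _
  (fun (r : 'I_n) m => p i r * unip_mx (s m) r j)) => r _.
apply: cvgM; first exact: cvg_cst.
rewrite (_ : (fun m => _) = (fun m => unip_entry (s m) r j)); last first.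
  by apply/funext => m; rewrite unip_mxE.
rewrite unip_mxE /unip_entry; case: (r < j)%N; last exact: cvg_cst.
have [lt|ge] := ltnP ('C(j, 2) + r) N; last first.
  rewrite nth_default ?size_tuple//.
  under eq_cvg do rewrite nth_default ?size_tuple//.
  exact: cvg_cst.
have := st (Ordinal lt); rewrite (tnth_nth 0)/=.
by under eq_cvg do rewrite (tnth_nth 0).
Qed.

End UnipotentMatrix.

(** * Directional derivatives and finite differences *)

Section DirectionalDerivative.
Variables (R : realType) (V : normedModType R).
Implicit Types (f h : V -> R) (x v w : V).

Lemma is_derive_line f x w (s : R) : derivable f (x + s *: w) w ->
  is_derive s 1 (fun y : R => f (x + y *: w)) ('D_w f (x + s *: w)).
Proof.
move=> df.
have E : (fun h : R => h^-1 *: (((fun y : R => f (x + y *: w)) \o shift s) (h *: 1)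
           - f (x + s *: w))) =
    (fun h : R => h^-1 *: ((f \o shift (x + s *: w)) (h *: w) - f (x + s *: w))).
  apply/funext => h /=; congr (_ *: (f _ - _)).
  by rewrite [h *: 1]mulr1 scalerDl addrCA addrA.
by split; [rewrite /derivable E|rewrite /derive E].
Qed.

Let quotient_line f x w :
  (fun h : R => h^-1 *: ((f \o shift x) (h *: w) - f x)) =
  (fun h : R => h^-1 *: (((fun y : R => f (x + y *: w)) \o shift 0) (h *: 1)
           - f (x + (0 : R) *: w))).
Proof.
apply/funext => h /=; rewrite scale0r !addr0 [h *: 1]mulr1.
by rewrite [x + _]addrC.
Qed.

Lemma derive_line f x w : 'D_w f x = 'D_1 (fun y : R => f (x + y *: w)) 0.
Proof. by rewrite /derive quotient_line. Qed.

Lemma derivable_line f x w :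
  derivable f x w = derivable (fun y : R => f (x + y *: w)) 0 1.
Proof. by rewrite /derivable quotient_line. Qed.

Lemma is_derive_line_scale f x w (c s : R) : derivable f (x + (s * c) *: w) w ->
  is_derive s 1 (fun y : R => f (x + (y * c) *: w)) (c * 'D_w f (x + (s * c) *: w)).
Proof.
move=> df.
have d1 : is_derive s 1 (fun y : R => y * c) c.
  have := @is_deriveM R R id (cst c) s 1 1 0 (is_derive_id _ _) (is_derive_cst _ _ _).
  by rewrite scaler0 add0r /= [c *: 1]mulr1.
rewrite mulrC; exact: (@is_derive1_comp R (fun y => f (x + y *: w))
  (fun y => y * c) s _ _ (is_derive_line df) d1).
Qed.

Lemma deriveZdir f x w (c : R) : derivable f x w ->
  derivable f x (c *: w) /\ 'D_(c *: w) f x = c * 'D_w f x.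
Proof.
move=> df; rewrite derive_line derivable_line.
have := @is_derive_line_scale f x w c 0.
rewrite mul0r scale0r addr0 => /(_ df).
rewrite (_ : (fun y : R => f (x + (y * c) *: w)) = (fun y : R => f (x + y *: (c *: w)))).
  by move=> [].
by apply/funext => y; rewrite scalerA.
Qed.

(* The increment along [v + w] is that along [v] followed by that along [w]; the
   mean value theorem turns the latter into a derivative at a nearby point. *)
Lemma deriveDdir (D : set V) f x v w : open D -> D x ->
  derivable f x v -> (forall y, D y -> derivable f y w) ->
  {for x, continuous (fun y => 'D_w f y)} ->
  derivable f x (v + w) /\ 'D_(v + w) f x = 'D_v f x + 'D_w f x.
Proof.
move=> oD Dx dv dw cw.
suff H : (fun h : R => h^-1 *: ((f \o shift x) (h *: (v + w)) - f x)) @ 0^' -->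
    'D_v f x + 'D_w f x.
  by split; [apply/cvg_ex; exists ('D_v f x + 'D_w f x)|exact: cvg_lim].
have E : (fun h : R => h^-1 *: ((f \o shift x) (h *: (v + w)) - f x)) =
   (fun h : R => h^-1 *: ((f \o shift x) (h *: v) - f x)) \+
   (fun h : R => h^-1 *: (f (x + h *: v + h *: w) - f (x + h *: v))).
  apply/funext => h /=; rewrite -scalerDr; congr (_ *: _).
  rewrite scalerDr [h *: v + _ + x]addrC addrA [h *: v + x]addrC.
  by rewrite [RHS]addrC addrA subrK.
rewrite E; apply: cvgD; first exact: dv.
apply/cvgrPdist_lt => e e0.
have /nbhs_ballP[r /= r0 Dr] : nbhs x D by exact: open_nbhs_nbhs.
move/cvgrPdist_lt : cw => /(_ e e0) /nbhs_ballP[d /= d0 xd].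
(* Within this radius of x the points lie in D and ['D_w f] is within e of its value at x. *)
pose m := Num.min r d.
have m0 : 0 < m by rewrite lt_min r0.
have near_x (h s : R) : `|h| * (`|v| + `|w| + 1) < m -> 0 <= s <= 1 ->
    ball x m (x + h *: v + (s * h) *: w).
  move=> hm /andP[s0 s1]; rewrite -ball_normE /= -addrA opprD addrA subrr sub0r normrN.
  apply: le_lt_trans hm; apply: (le_trans (ler_normD _ _)).
  rewrite !normrZ (ger0_norm s0).
  have := normr_ge0 h; have := normr_ge0 v; have := normr_ge0 w.
  move=> w0 v0 h0; rewrite -addrA !mulrDr lerD2l mulr1.
  have : s * `|h| * `|w| <= `|h| * `|w| by rewrite -mulrA ler_piMl// mulr_ge0.
  lra.
near=> h.
have h_neq0 : h != 0 by near: h; exact: nbhs_dnbhs_neq.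
have hm : `|h| * (`|v| + `|w| + 1) < m.
  have k0 : 0 < `|v| + `|w| + 1 by rewrite ltr_wpDl// addr_ge0.
  rewrite -ltr_pdivlMr//; near: h; apply: dnbhs0_lt.
  by rewrite divr_gt0.
pose phi (s : R) := f (x + h *: v + (s * h) *: w).
have dphi (s : R) : 0 <= s <= 1 ->
    is_derive s 1 phi (h * 'D_w f (x + h *: v + (s * h) *: w)).
  move=> s01; apply: is_derive_line_scale; apply: dw; apply: Dr.
  by apply: le_ball (near_x _ _ hm s01); rewrite ge_min lexx.
have [||s s01 E'] := @MVT_segment R phi
  (fun s => h * 'D_w f (x + h *: v + (s * h) *: w)) 0 1 ler01.
- by move=> s; rewrite in_itv/= => /andP[/ltW s0 /ltW s1]; apply: dphi; rewrite s0.
- apply: derivable_within_continuous => s; rewrite in_itv/= => s01.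
  by have [] := dphi s s01.
rewrite in_itv/= in s01.
have -> : h^-1 *: (f (x + h *: v + h *: w) - f (x + h *: v)) =
    'D_w f (x + h *: v + (s * h) *: w).
  move: E'; rewrite /phi mul1r mul0r scale0r addr0 subr0 mulr1 => ->.
  by rewrite [LHS]mulKf.
by apply: xd; apply: le_ball (near_x _ _ hm s01); rewrite ge_min lexx orbT.
Unshelve. all: by end_near. Qed.

Variable D : set V.
Hypothesis oD : open D.

Lemma derive_eq_on f h x w : (forall y, D y -> f y = h y) -> D x ->
  'D_w f x = 'D_w h x.
Proof.
move=> fh Dx; apply: near_eq_derive; near=> y; apply: fh; near: y.
exact: open_nbhs_nbhs.
Unshelve. all: by end_near. Qed.

Definition iter_derive m w f : V -> R := iter m (fun h x => 'D_w h x) f.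

Lemma iter_deriveS m w f : iter_derive m.+1 w f = iter_derive m w (fun x => 'D_w f x).
Proof. exact: iterSr. Qed.

Lemma iter_derive_eq_on m w f h : (forall y, D y -> f y = h y) ->
  forall x, D x -> iter_derive m w f x = iter_derive m w h x.
Proof.
elim: m f h => [|m IH] f h fh x Dx; first exact: fh.
rewrite !iter_deriveS; apply: IH => // y Dy; exact: derive_eq_on.
Qed.

Lemma Ck_onW k f : Ck_on k.+1 D f -> Ck_on k D f.
Proof.
elim: k f => [|k IH] f /= [cf df]; split => // w; have [dw [cw ddw]] := df w.
by split => //; apply: IH; split.
Qed.

Lemma Ck_on_iter_derive m k w f : Ck_on (m + k) D f -> Ck_on k D (iter_derive m w f).
Proof.
by elim: m f => [//|m IH] f /= [_ /(_ w)[_ /IH]]; rewrite -iter_deriveS.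
Qed.

Lemma derive_sum_scale (I : Type) (s : seq I) (c : I -> R) (h : I -> V -> R) x w :
  (forall i, derivable (h i) x w) ->
  is_derive x w (fun y => \sum_(i <- s) c i * h i y) (\sum_(i <- s) c i * 'D_w (h i) x).
Proof.
move=> dh; elim: s => [|i s IH].
  rewrite big_nil; under eq_fun do rewrite big_nil.
  exact: is_derive_cst.
rewrite big_cons; under eq_fun do rewrite big_cons.
apply: is_deriveD; apply: is_deriveZ; exact: derivableP.
Qed.

Lemma iter_derive_sum m (I : Type) (s : seq I) (c : I -> R) (h : I -> V -> R) w :
  (forall i, Ck_on m D (h i)) -> forall x, D x ->
  iter_derive m w (fun y => \sum_(i <- s) c i * h i y) x =
  \sum_(i <- s) c i * iter_derive m w (h i) x.
Proof.
elim: m h => [//|m IH] h Ch x Dx; rewrite iter_deriveS.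
have Ch' i : Ck_on m D (fun y => 'D_w (h i) y) by have [_ /(_ w)[]] := Ch i.
rewrite (@iter_derive_eq_on m w _ (fun y => \sum_(i <- s) c i * 'D_w (h i) y)) => //.
  by rewrite IH//; apply: eq_bigr => i _; rewrite iter_deriveS.
move=> y Dy; have [//|_ ->//] := @derive_sum_scale I s c h y w.
by move=> i; have [_ /(_ w)[dw _]] := Ch i; exact: dw.
Qed.

(** Linearity in the direction is not part of [Ck_on], which treats each direction on its own; it
    follows from [deriveDdir] through the continuity of the derivatives. *)
Lemma derive_sum_dir f x (I : Type) (s : seq I) (c : I -> R) (e : I -> V) :
  Ck_on 1 D f -> D x ->
  'D_(\sum_(i <- s) c i *: e i) f x = \sum_(i <- s) c i * 'D_(e i) f x.
Proof.
move=> [_ Cf] Dx.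
have df w y : D y -> derivable f y w by have [+ _] := Cf w; apply.
have cf w : {for x, continuous (fun y => 'D_w f y)} by have [_ [+ _]] := Cf w; apply.
elim: s => [|i s IH]; first by rewrite !big_nil derive0.
rewrite !big_cons addrC.
have [_ ->] := @deriveDdir D f x (\sum_(j <- s) c j *: e j) (c i *: e i) oD Dx
  (df _ _ Dx) (df _) (cf _).
by rewrite IH addrC (proj2 (@deriveZdir f x (e i) (c i) (df _ _ Dx))).
Qed.

Lemma is_derive_iter_derive m w f x (s : R) :
  Ck_on m.+1 D f -> D (x + s *: w) ->
  is_derive s 1 (fun y : R => iter_derive m w f (x + y *: w))
    (iter_derive m.+1 w f (x + s *: w)).
Proof.
move=> Cf Dx; have [_ /(_ w)[dw _]] : Ck_on 1 D (iter_derive m w f).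
  by apply: Ck_on_iter_derive; rewrite addn1.
exact: (@is_derive_line (iter_derive m w f) x w s (dw _ Dx)).
Qed.

End DirectionalDerivative.

(** * Finite differences on the line *)

Section FiniteDifference.
Variable R : realType.

Fixpoint fdiff N (s : R) (phi : R -> R) : R -> R :=
  if N is N'.+1 then fdiff N' s (fun x => phi x - phi (x + s)) else phi.

(** By the mean value theorem each difference costs one derivative and gains a factor s. The
    interval where the bound is available shrinks from B to B - s, as the difference also evaluates
    at x + s. *)
Lemma fdiff_bound N (s B M : R) (phi : nat -> R -> R) : 0 <= s ->
  (forall (m : nat) (x : R), (m < N)%N -> is_derive x 1 (phi m) (phi m.+1 x)) ->
  (forall x, 0 <= x <= B -> `|phi N x| <= M) ->
  forall y, 0 <= y -> y + N%:R * s <= B -> `|fdiff N s (phi 0%N) y| <= M * s ^+ N.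
Proof.
move=> s0; elim: N B M phi => [|N IH] B M phi dphi Mphi y y0 yB.
  by rewrite expr0 mulr1 Mphi// y0; move: yB; rewrite mul0r addr0.
rewrite exprS mulrA /=.
apply: (IH (B - s) (M * s) (fun m x => phi m x - phi m (x + s))) => //; last first.
- by move: yB; rewrite lerBrDr -natr1 mulrDl mul1r addrA.
- move=> x /andP[x0 xB]; have xs : x <= x + s by rewrite lerDl.
  have d (z : R) : is_derive z 1 (phi N) (phi N.+1 z) by exact: dphi.
  have [|z + E] := @MVT_segment R (phi N) (phi N.+1) x (x + s) xs (fun z _ => d z).
  + by apply: derivable_within_continuous => z _; have [] := d z.
  + rewrite in_itv/= => /andP[xz zx].
    rewrite distrC E addrAC subrr add0r normrM (ger0_norm s0) ler_wpM2r//.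
    by apply: Mphi; rewrite (le_trans x0 xz)/= (le_trans zx)// -lerBrDr.
- move=> m x mN; apply: is_deriveB; first by apply: dphi; exact: ltnW.
  have d1 : is_derive x 1 (fun z : R => z + s) 1.
    by rewrite -[X in is_derive _ _ _ X]addr0; apply: is_deriveD.
  have := @is_derive1_comp R (phi m) (fun z => z + s) x _ _ (dphi m (x + s) (ltnW mN)) d1.
  by rewrite mulr1.
Qed.

End FiniteDifference.

(** * Uniform bounds on compact sets of matrices *)

Section SmoothBounds.
Variables (R : realType) (n : nat).
Implicit Types (f : 'M[R]_n -> R) (A w : 'M[R]_n).

Definition mx_bounded (r : R) : set 'M[R]_n := [set A | forall i j, `|A i j| <= r].

(** The condition on the determinant is closed, keeps the set inside GL, and holds for products of
    orthogonal and unipotent matrices. *)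
Definition compactGL (r : R) : set 'M[R]_n :=
  mx_bounded r `&` [set A | \det A ^+ 2 = 1].

Lemma compact_mx_bounded r : compact (mx_bounded r).
Proof.
pose box := [set v : 'rV[R]_(n * n) | forall i, `[- r, r]%classic (v ord0 i)].
have cvec : continuous (vec_mx : 'rV[R]_(n * n) -> 'M[R]_n).
  move=> v; apply: (@cvg_mx R _ (nbhs v) _ n n vec_mx (vec_mx v)) => i j.
  rewrite mxE; under eq_cvg do rewrite mxE.
  exact: (@coord_continuous R 1 (n * n) ord0 (mxvec_index i j) v).
rewrite (_ : mx_bounded r = vec_mx @` box).
  apply: continuous_compact; first exact: continuous_subspaceT.
  by apply: (@rV_compact R _ (fun=> `[- r, r]%classic)) => i; exact: segment_compact.
apply/seteqP; split=> A /=.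
  move=> Ar; exists (mxvec A); last exact: mxvecK.
  move=> k; case/mxvec_indexP: k => i j; rewrite mxvecE /= in_itv/= -ler_norml.
  exact: Ar.
by move=> [v vr <-] i j; rewrite mxE ler_norml; have := vr (mxvec_index i j); rewrite /= in_itv.
Qed.

Lemma compact_compactGL r : compact (compactGL r).
Proof.
apply: (@subclosed_compact _ _ (mx_bounded r)); last by move=> A [].
  apply: closedI.
    apply: compact_closed; first exact: norm_hausdorff.
    exact: compact_mx_bounded.
  rewrite (_ : [set A | _] = (fun A : 'M[R]_n => (\det A) ^+ 2 : R) @^-1` [set x | x = 1])//.
  apply: closed_comp => [A _|]; last exact: closed_eq.
  apply: (@continuous_comp _ _ _ (fun A : 'M[R]_n => \det A : R) (fun x : R => x ^+ 2)).
    exact: continuous_det.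
  exact: exprn_continuous.
exact: compact_mx_bounded.
Qed.

Lemma sub_compactGL_GL r : compactGL r `<=` @GL R n.
Proof.
move=> A [_ /= dA]; rewrite /GL/= unitmxE unitfE; apply/eqP => d0.
by move/eqP: dA; rewrite d0 expr0n/= eq_sym oner_eq0.
Qed.

(** Continuity bounds the derivatives for one direction at a time. Uniformity in w comes from
    expanding w in the matrix units: the coefficients are at most r, and finitely many derivatives
    remain. *)
Lemma iter_derive_bounded (D K : set 'M[R]_n) (r : R) m f :
  open D -> compact K -> K `<=` D -> 0 <= r -> Ck_on m D f ->
  exists2 C : R, 0 <= C &
    forall A w, K A -> mx_bounded r w -> `|iter_derive m w f A| <= C.
Proof.
move=> oD cK KD r0; elim: m f => [|m IH] f.
  move=> [cf _]; have cfK : compact (f @` K).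
    apply: continuous_compact => //; apply: continuous_in_subspaceT => A.
    by rewrite inE => /KD; exact: cf.
  have [M [_ /(_ (`|M| + 1))]] := compact_bounded cfK.
  move=> H; exists (`|M| + 1); first by rewrite addr_ge0.
  move=> A w KA _; apply: H; last by exists A.
  by rewrite (le_lt_trans (ler_norm _))// ltrDl.
move=> Cf.
have Cdf w : Ck_on m D (fun A => 'D_w f A) by have [_ /(_ w)[]] := Cf.
have Cf1 : Ck_on 1 D f.
  by elim: (m) Cf => [//|k IHk] /Ck_onW.
have /choice[C HC] (p : 'I_n * 'I_n) : exists C : R, 0 <= C /\
    forall A w, K A -> mx_bounded r w ->
    `|iter_derive m w (fun A => 'D_(delta_mx p.1 p.2) f A) A| <= C.
  by have [C C0 HC] := IH _ (Cdf (delta_mx p.1 p.2)); exists C.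
exists (\sum_p r * C p).
  by apply: sumr_ge0 => p _; rewrite mulr_ge0//; have [] := HC p.
move=> A w KA wr; rewrite iter_deriveS.
rewrite (@iter_derive_eq_on R _ D oD m w _
  (fun B => \sum_(p : 'I_n * 'I_n) w p.1 p.2 * 'D_(delta_mx p.1 p.2) f B)); first last.
- exact: KD.
- move=> B DB; rewrite -(derive_sum_dir oD _ _ (fun p : 'I_n * 'I_n => delta_mx p.1 p.2) Cf1 DB).
  congr ('D_ _ f B); by rewrite {1}(matrix_sum_delta w) pair_big.
rewrite (iter_derive_sum oD)//; last exact: KD.
apply: (le_trans (ler_norm_sum _ _ _)); apply: ler_sum => p _.
by rewrite normrM ler_pM//; have [_] := HC p; apply.
Qed.

Lemma fdiff_line_bounded (r : R) N f : 0 <= r -> (forall k, Ck_on k (@GL R n) f) ->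
  exists2 C : R, 0 <= C & forall A w (s : R), 0 <= s <= 1 ->
    (forall x : R, GL (A + x *: w)) ->
    (forall x : R, 0 <= x <= N%:R -> compactGL r (A + x *: w)) -> mx_bounded r w ->
    `|fdiff N s (fun x => f (A + x *: w)) 0| <= C * s ^+ N.
Proof.
move=> r0 Cf.
have [C C0 HC] := iter_derive_bounded (@open_GL R n) (@compact_compactGL r)
  (@sub_compactGL_GL r) r0 (Cf N).
exists C => // A w s /andP[s0 s1] GLA cA wr.
(* Since s <= 1, the N-th difference at 0 only samples parameters in [0, N]. *)
apply: (@fdiff_bound R N s N%:R C (fun m x => iter_derive m w f (A + x *: w))) => //.
- by move=> m x _; exact: is_derive_iter_derive.
- by move=> x xN; apply: HC => //; exact: cA.
- by rewrite add0r ler_piMr.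
Qed.

End SmoothBounds.

(** * Complex-valued integrals *)

Section ComplexModulus.
Variable R : realType.
Implicit Types z w : R[i].

(** The norm of [R[i]] takes values in [R[i]]; estimates by real integrals call for a modulus in
    R. *)
Definition cabs z : R := Num.sqrt (complex.Re z ^+ 2 + complex.Im z ^+ 2).

Lemma normr_cabs z : `|z| = (cabs z)%:C.
Proof. exact: normc_def. Qed.

Lemma cabs_ge0 z : 0 <= cabs z. Proof. exact: sqrtr_ge0. Qed.

Lemma cabsM z w : cabs (z * w) = cabs z * cabs w.
Proof. by apply: complexI; rewrite -normr_cabs normrM !normr_cabs -rmorphM. Qed.

Lemma cabs1 : cabs 1 = 1.
Proof. by apply: complexI; rewrite -normr_cabs normr1. Qed.

Lemma cabs_real (x : R) : cabs x%:C = `|x|.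
Proof. by rewrite /cabs /= expr0n/= addr0 sqrtr_sqr. Qed.

Lemma cabs_prod (I : Type) (s : seq I) (P : pred I) (F : I -> R[i]) :
  cabs (\prod_(i <- s | P i) F i) = \prod_(i <- s | P i) cabs (F i).
Proof. by apply: (big_morph cabs cabsM cabs1). Qed.

Lemma Re_le_cabs z : `|complex.Re z| <= cabs z.
Proof. by rewrite -sqrtr_sqr ler_wsqrtr// lerDl sqr_ge0. Qed.

Lemma Im_le_cabs z : `|complex.Im z| <= cabs z.
Proof. by rewrite -sqrtr_sqr ler_wsqrtr// lerDr sqr_ge0. Qed.

Lemma cabs_le_ReIm z : cabs z <= `|complex.Re z| + `|complex.Im z|.
Proof.
rewrite -[leRHS]ger0_norm ?addr_ge0// -sqrtr_sqr ler_wsqrtr//.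
rewrite -(real_normK (num_real (complex.Re z))) -(real_normK (num_real (complex.Im z))).
have := normr_ge0 (complex.Re z); have := normr_ge0 (complex.Im z); nra.
Qed.

Lemma cabs_cexp z : cabs (cexp z) = expR (complex.Re z).
Proof.
rewrite /cexp cabsM cabs_real ger0_norm ?expR_ge0//.
by rewrite /cabs /= cos2Dsin2 sqrtr1 mulr1.
Qed.

Lemma cexpD z w : cexp (z + w) = cexp z * cexp w.
Proof.
case: z => a b; case: w => c d; rewrite /cexp /= expRD cosD sinD.
by apply/eqP; rewrite eq_complex /=; apply/andP; split; apply/eqP; ring.
Qed.

End ComplexModulus.

Section ComplexIntegral.
Context d (T : measurableType d) (R : realType) (mu : {measure set T -> \bar R}).
Implicit Types (F H : T -> R[i]) (G : T -> R).

Definition cmeasurable F := measurable_fun setT (fun t => complex.Re (F t)) /\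
  measurable_fun setT (fun t => complex.Im (F t)).

Definition cintegrable F :=
  mu.-integrable setT (EFin \o (fun t => complex.Re (F t))) /\
  mu.-integrable setT (EFin \o (fun t => complex.Im (F t))).

Lemma cmeasurableM F H : cmeasurable F -> cmeasurable H ->
  cmeasurable (fun t => F t * H t).
Proof.
move=> [rF iF] [rH iH]; split.
  apply: (eq_measurable_fun (fun t => complex.Re (F t) * complex.Re (H t) -
      complex.Im (F t) * complex.Im (H t))).
    by move=> t _; case: (F t) => ? ?; case: (H t).
  by apply: measurable_funB; exact: measurable_funM.
apply: (eq_measurable_fun (fun t => complex.Re (F t) * complex.Im (H t) +
    complex.Im (F t) * complex.Re (H t))).
  by move=> t _; case: (F t) => ? ?; case: (H t).
by apply: measurable_funD; exact: measurable_funM.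
Qed.

Lemma cintegrable_dominated F G : cmeasurable F ->
  mu.-integrable setT (EFin \o G) -> (forall t, cabs (F t) <= G t) -> cintegrable F.
Proof.
move=> [rF iF] iG FG; split; apply: (le_integrable measurableT _ _ iG).
- exact/measurable_EFinP.
- move=> t _ /=; rewrite lee_fin (le_trans (Re_le_cabs _))// (le_trans (FG t))//.
  exact: ler_norm.
- exact/measurable_EFinP.
- move=> t _ /=; rewrite lee_fin (le_trans (Im_le_cabs _))// (le_trans (FG t))//.
  exact: ler_norm.
Qed.

(** The factor 2 comes from estimating real and imaginary parts separately; only finiteness of the
    constant matters later. *)
Lemma cabs_cintegral_le F G : cmeasurable F ->
  mu.-integrable setT (EFin \o G) -> (forall t, cabs (F t) <= G t) ->
  cabs (cintegral mu F) <= 2 * \int[mu]_(t in setT) G t.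
Proof.
move=> mF iG FG; have [rF iF] := cintegrable_dominated mF iG FG.
apply: (le_trans (cabs_le_ReIm _)); rewrite /cintegral /= mulrDl mul1r.
apply: lerD; (apply: (le_trans (le_normr_Rintegral _ _)) => //);
  apply: le_Rintegral => //; try exact: integrable_norm.
- by move=> t _; apply: le_trans (FG t); exact: Re_le_cabs.
- by move=> t _; apply: le_trans (FG t); exact: Im_le_cabs.
Qed.

Lemma cintegralB F H : cintegrable F -> cintegrable H ->
  cintegral mu (fun t => F t - H t) = cintegral mu F - cintegral mu H.
Proof.
move=> [rF iF] [rH iH]; rewrite /cintegral.
rewrite -[RHS]/((_ - _) +i* (_ - _)) -!RintegralB//.
by congr (_ +i* _); apply: eq_Rintegral => t _; case: (F t) => ? ?; case: (H t).
Qed.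

Lemma cintegralZl F (c : R[i]) : cintegrable F ->
  cintegral mu (fun t => c * F t) = c * cintegral mu F.
Proof.
case: c => a b [rF iF]; rewrite /cintegral.
rewrite -[RHS]/((_ - _) +i* (_ + _)) -!RintegralZl//.
have iZ (x : R) (f : T -> R) : mu.-integrable setT (EFin \o f) ->
    mu.-integrable setT (EFin \o (fun t => x * f t)).
  by move=> /(integrableZl measurableT x).
rewrite -RintegralB//; try exact: iZ.
rewrite -RintegralD//; try exact: iZ.
by congr (_ +i* _); apply: eq_Rintegral => t _; case: (F t).
Qed.

End ComplexIntegral.

(** * Translations of the unipotent group *)

Section ChangeOfVariables.
Variables (R : realType) (N : nat).
Local Notation RT := (measurableTypeR R).
Local Notation mu := (@lebesgue_tuple R N).

(** The identity is proved in the extended reals on positive and negative parts, then passed through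
    [fine], which sends infinite values on either side to 0. *)
Lemma Rintegral_triangular_map (a b : 'I_N -> N.-tuple RT -> R) (J : R) :
  (forall k, measurable_fun setT (a k)) -> (forall k, measurable_fun setT (b k)) ->
  (forall k, depends_after k (a k)) -> (forall k, depends_after k (b k)) ->
  (forall k t, 0 < a k t) -> (forall t, \prod_(k < N) a k t = J) ->
  forall f : N.-tuple RT -> R, measurable_fun setT f ->
  J * \int[mu]_(t in setT) f (triangular_map a b t) = \int[mu]_(t in setT) f t.
Proof.
move=> ma mb da db a0 aJ f mf; pose S := triangular_map a b.
have J0 : 0 < J by rewrite -(aJ [tuple 0 | _ < N]) prodr_gt0.
have mS : measurable_fun setT S by exact: measurable_triangular_map.
have ge0_int (F : N.-tuple RT -> \bar R) : measurable_fun setT F ->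
    (forall t, 0 <= F t)%E -> (J%:E * \int[mu]_t F (S t) = \int[mu]_t F t)%E.
  move=> mF F0; rewrite -(ge0_integral_triangular_map ma mb da db a0 mF F0).
  rewrite -ge0_integralZl//=.
  - by apply: eq_integral => t _; rewrite aJ muleC.
  - exact: measurableT_comp.
  - by rewrite lee_fin ltW.
have mulB (x y : \bar R) : (J%:E * (x - y) = J%:E * x - J%:E * y)%E.
  by case: x y => [x| |] [y| |];
    rewrite /= ?(gt0_muley, gt0_muleNy, gt0_muley) ?lte_fin// -?EFinB -?EFinM -?EFinB ?mulrBr//.
have E : (J%:E * \int[mu]_t (f (S t))%:E = \int[mu]_t (f t)%:E)%E.
  rewrite integralE mulB [RHS]integralE.
  rewrite -(ge0_int ((EFin \o f)^\+)%E) -?(ge0_int ((EFin \o f)^\-)%E)//.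
  - by congr (_ * _ - _ * _)%E; apply: eq_integral => t _; rewrite ?funeposE ?funenegE.
  - by apply: measurable_funeneg; exact/measurable_EFinP.
  - by apply: measurable_funepos; exact/measurable_EFinP.
rewrite /Rintegral -E; case: (\int[mu]_t _)%E => [x| |] /=.
- by [].
- by rewrite gt0_muley ?lte_fin//= mulr0.
- by rewrite gt0_muleNy ?lte_fin//= mulr0.
Qed.

Lemma cintegral_triangular_map (a b : 'I_N -> N.-tuple RT -> R) (J : R) :
  (forall k, measurable_fun setT (a k)) -> (forall k, measurable_fun setT (b k)) ->
  (forall k, depends_after k (a k)) -> (forall k, depends_after k (b k)) ->
  (forall k t, 0 < a k t) -> (forall t, \prod_(k < N) a k t = J) ->
  forall F : N.-tuple RT -> R[i], cmeasurable F ->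
  J%:C * cintegral mu (fun t => F (triangular_map a b t)) = cintegral mu F.
Proof.
move=> ma mb da db a0 aJ F [rF iF].
have rE := Rintegral_triangular_map ma mb da db a0 aJ rF.
have iE := Rintegral_triangular_map ma mb da db a0 aJ iF.
rewrite /cintegral -rE -iE.
by apply/eqP; rewrite eq_complex /= !mul0r subr0 addr0 !eqxx.
Qed.

End ChangeOfVariables.

Section Translation.
Variables (R : realType) (n : nat).
Local Notation RT := (measurableTypeR R).
Local Notation N := 'C(n, 2).

Lemma upper_col_lt (k : 'I_N) : ((upper_index k).2 < n)%N.
Proof. exact: upper_index_lt. Qed.

Lemma upper_row_lt (k : 'I_N) : ((upper_index k).1 < n)%N.
Proof. by apply: ltn_trans (upper_col_lt k); have [] := upper_indexP k. Qed.

Definition urow k : 'I_n := Ordinal (upper_row_lt k).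
Definition ucol k : 'I_n := Ordinal (upper_col_lt k).

Variables (u a : 'M[R]_n).
Hypotheses (Uu : unipU u) (Aa : torusA a).

Let alpha (k : 'I_N) (_ : N.-tuple RT) : R := a (urow k) (urow k) / a (ucol k) (ucol k).
Let beta (k : 'I_N) (t : N.-tuple RT) : R :=
  \sum_(r < n | (urow k < r)%N)
    u (urow k) r * a r r / a (ucol k) (ucol k) * unip_entry t r (ucol k).

(* [t |-> y'] with [unip_mx y' = u a (unip_mx y) a^-1] *)
Definition translate_map := triangular_map alpha beta.

Definition translate_jacobian : R :=
  \prod_(k < N) (a (urow k) (urow k) / a (ucol k) (ucol k)).

Let aE (A : 'M[R]_n) i j : (a *m A) i j = a i i * A i j.
Proof.
case: Aa => /diag_mxP[d ->] _.
by rewrite mul_diag_mx !mxE eqxx mulr1n.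
Qed.

Let aEr (A : 'M[R]_n) i j : (A *m a) i j = A i j * a j j.
Proof.
case: Aa => /diag_mxP[d ->] _.
by rewrite mul_mx_diag !mxE eqxx mulr1n.
Qed.

Lemma unip_mx_translate t : unip_mx (translate_map t) *m a = u *m a *m unip_mx t.
Proof.
have [u1 u0] := Uu; have [_ a0] := Aa.
apply/matrixP => r c; rewrite aEr -mulmxA unip_mxE [RHS]mxE.
have E : \sum_j u r j * (a *m unip_mx t) j c =
    a r r * unip_entry t r c + \sum_(j < n | (r < j)%N) u r j * a j j * unip_entry t j c.
  rewrite (bigD1 r)//= u1 mul1r aE unip_mxE; congr (_ + _).
  rewrite big_mkcond [RHS]big_mkcond/=; apply: eq_bigr => j _.
  rewrite aE unip_mxE neq_ltn; case: ltngtP => //= jr; last by rewrite mulrA.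
  by rewrite u0// mul0r.
rewrite E; have [rc|cr|] := ltngtP r c.
- have kN : ('C(c, 2) + r < N)%N by exact: bin2_row_lt.
  pose k := Ordinal kN.
  have kE : upper_index k = (r : nat, c : nat) by exact: upper_indexK.
  have kr : urow k = r by apply: val_inj; rewrite /= -/(nat_of_ord k) kE.
  have kc : ucol k = c by apply: val_inj; rewrite /= -/(nat_of_ord k) kE.
  have := unip_entry_upper (translate_map t) k.
  rewrite kE /= => ->; rewrite tnth_mktuple /alpha /beta kr kc -(unip_entry_upper t k) kE /=.
  rewrite mulrDl mulr_suml mulrAC divfK ?gt_eqF//; congr (_ + _).
  apply: eq_bigr => j _; field; exact: lt0r_neq0.
- rewrite !unip_entry_low// mul0r mulr0 add0r big1// => j rj.
  by rewrite unip_entry_low ?mulr0//; exact: ltn_trans rj.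
- move=> /val_inj <-; rewrite !unip_entry_diag mul1r mulr1 big1 ?addr0// => j rj.
  by rewrite unip_entry_low ?mulr0.
Qed.

Lemma cintegral_translate (F : N.-tuple RT -> R[i]) : cmeasurable F ->
  translate_jacobian%:C * cintegral (@lebesgue_tuple R N) (fun t => F (translate_map t)) =
  cintegral (@lebesgue_tuple R N) F.
Proof.
have [_ a0] := Aa; apply: cintegral_triangular_map => //.
- by move=> k; exact: measurable_cst.
- move=> k; rewrite /beta; under eq_fun do rewrite big_mkcond/=.
  apply: (@measurable_sum _ (N.-tuple RT) R setT _ _
    (fun (r : 'I_n) (t : N.-tuple RT) => if (urow k < r)%N then
    u (urow k) r * a r r / a (ucol k) (ucol k) * unip_entry t r (ucol k) else 0)) => r.
  case: (urow k < r)%N; last exact: measurable_cst.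
  by apply: measurable_funM => //; exact: measurable_unip_entry.
- move=> k t t' /unip_entry_agree[_ H]; apply: eq_bigr => r kr.
  by rewrite H.
- by move=> k t; rewrite divr_gt0.
Qed.

End Translation.

(** * Torus characters and difference operators *)

Section TorusCharacters.
Variables (R : realType) (n : nat).
Implicit Types (a : 'M[R]_n) (lam : 'I_n -> R[i]).

Lemma cabs_apow a lam :
  cabs (apow a lam) = expR (\sum_i complex.Re (lam i) * ln (a i i)).
Proof.
rewrite /apow cabs_prod expR_sum; apply: eq_bigr => i _.
by rewrite cabs_cexp; case: (lam i) => x y /=; rewrite mulr0 subr0.
Qed.

Lemma Re_rho (i : 'I_n) : complex.Re (rho R i) = (n%:R - 1 - 2 * i%:R) / 2.
Proof. by []. Qed.

(** An index i is the smaller one in m - 1 - i pairs and the larger one in i pairs. The resulting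
    coefficient is twice the entry of rho, so the Jacobian of conjugation by a is a^(2 rho). *)
Lemma sum_upper_sub (l : nat -> R) m :
  \sum_(0 <= c < m) \sum_(0 <= i < c) (l i - l c) =
  \sum_(0 <= i < m) (m%:R - 1 - 2 * i%:R) * l i.
Proof.
elim: m => [|m IH]; first by rewrite !big_geq.
rewrite !big_nat_recr//= IH sumrB sumr_const_nat subn0.
rewrite addrA -big_split/= -mulr_natl -natr1.
congr (_ + _); last by ring.
by apply: eq_bigr => i _; ring.
Qed.

Definition ext_ord (g : 'I_n -> R) (c : nat) : R := oapp g 0 (insub c).

Lemma ext_ordE g (i : 'I_n) : ext_ord g i = g i.
Proof. by rewrite /ext_ord valK. Qed.

Lemma translate_jacobianE a : torusA a ->
  translate_jacobian a = expR (\sum_i (2 * complex.Re (rho R i)) * ln (a i i)).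
Proof.
move=> [_ a0]; pose l := ext_ord (fun i => ln (a i i)).
transitivity (\prod_(k < 'C(n, 2))
    (fun i c => expR (l i - l c)) (upper_index k).1 (upper_index k).2).
  apply: eq_bigr => k _ /=.
  have -> : l (upper_index k).1 = ln (a (urow k) (urow k)) by exact: (ext_ordE _ (urow k)).
  have -> : l (upper_index k).2 = ln (a (ucol k) (ucol k)) by exact: (ext_ordE _ (ucol k)).
  rewrite -ln_div ?posrE//.
  by rewrite lnK// posrE divr_gt0.
rewrite (prod_upper_index n (fun i c => expR (l i - l c))); under eq_bigr do rewrite -expR_sum.
rewrite -expR_sum sum_upper_sub big_mkord; congr expR.
by apply: eq_bigr => i _; rewrite /l ext_ordE Re_rho mulrCA divff ?mulr1// pnatr_eq0.
Qed.

End TorusCharacters.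

(** * Differences under left translation *)

Section TranslationDifference.
Variables (R : realType) (n : nat).

(** The target is any additive group, so that differences of a complex function can be compared with
    those of its real and imaginary parts. *)
Definition tdiff (V : zmodType) (X : 'M[R]_n) (s : R) (F : 'M[R]_n -> V) :
    'M[R]_n -> V :=
  fun y => F y - F ((1%:M + s *: X) *m y).

Lemma iter_tdiff_morph (V W : zmodType) (h : {additive V -> W}) X s m F y :
  h (iter m (@tdiff V X s) F y) = iter m (@tdiff W X s) (h \o F) y.
Proof.
elim: m y => [//|m IH] y; rewrite !iterS /tdiff raddfB !IH//.
Qed.

(** As X^2 = 0, the product of 1 + x X and 1 + s X is 1 + (x + s) X. *)
Lemma iter_tdiff_fdiff X s m (F : 'M[R]_n -> R) y x : X *m X = 0 ->
  iter m (tdiff X s) F ((1%:M + x *: X) *m y) =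
  fdiff m s (fun x' => F ((1%:M + x' *: X) *m y)) x.
Proof.
move=> XX; elim: m F => [//|m IH] F; rewrite iterSr IH /=; congr fdiff.
apply/funext => x'; rewrite /tdiff mulmxA; congr (_ - F (_ *m y)).
rewrite mulmxDl mul1mx mulmxDr mulmx1 -scalemxAl -scalemxAr XX !scaler0 addr0.
by rewrite -addrA -scalerDl.
Qed.

End TranslationDifference.

Section OrthogonalMatrices.
Variables (R : realType) (n : nat).
Implicit Types (p kappa : 'M[R]_n).

Lemma orthoK_unit p : orthoK p -> p \in unitmx.
Proof. by move=> pp; have [] := mulmx1_unit pp. Qed.

Lemma orthoK_mul p kappa : orthoK p -> orthoK kappa -> orthoK (p *m kappa).
Proof.
rewrite /orthoK/= => pp kk.
by rewrite trmx_mul mulmxA -(mulmxA p) kk mulmx1.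
Qed.

Lemma orthoK_tr p : orthoK p -> orthoK p^T.
Proof. by rewrite /orthoK/= trmxK => /mulmx1C. Qed.

Lemma orthoK_entry p i j : orthoK p -> `|p i j| <= 1.
Proof.
move=> pp; have /matrixP/(_ i i) := pp; rewrite !mxE eqxx => E.
rewrite -sqrtr_sqr -[leRHS]sqrtr1 ler_wsqrtr// -[leRHS]E (bigD1 j)//= mxE expr2.
by rewrite lerDl sumr_ge0// => r _; rewrite mxE; exact: sqr_ge0.
Qed.

Lemma orthoK_det p : orthoK p -> \det p ^+ 2 = 1.
Proof. by move=> pp; rewrite expr2 -{2}det_tr -det_mulmx pp det1. Qed.

End OrthogonalMatrices.

Section SimpleRoots.
Variables (R : realType) (n : nat) (i : 'I_n.-1).

Definition root_mx : 'M[R]_n := delta_mx (ord_lo i) (ord_hi i).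

Lemma root_mx_sq0 : root_mx *m root_mx = 0.
Proof. by rewrite mul_delta_mx_0// -val_eqE gtn_eqF. Qed.

Lemma unipU_root (s : R) : unipU (1%:M + s *: root_mx).
Proof.
split=> [j|j k kj]; rewrite !mxE.
  rewrite eqxx; have [->|_] := eqVneq j (ord_lo i); last by rewrite mulr0 addr0.
  by rewrite -val_eqE /= ltn_eqF// mulr0 addr0.
rewrite (gtn_eqF kj : (j == k) = false) add0r.
have [jl|_] := eqVneq j (ord_lo i); last by rewrite mulr0.
have [kh|_] := eqVneq k (ord_hi i); last by rewrite mulr0.
by move: kj; rewrite jl kh /= ltnNge leqnSn.
Qed.

End SimpleRoots.

Lemma det_unipU (R : realType) n (u : 'M[R]_n) : unipU u -> \det u = 1.
Proof.
move=> [u1 u0]; rewrite -det_tr det_trig; last first.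
  by apply/is_trig_mxP => i j ij; rewrite mxE u0.
by rewrite big1// => i _; rewrite mxE u1.
Qed.

Lemma finite_pos_lower_bound (R : realType) (I : finType) (P : pred I) (g : I -> R) :
  (forall i, P i -> 0 < g i) -> exists2 e : R, 0 < e & forall i, P i -> e <= g i.
Proof.
(* The seed 1 keeps the minimum positive when no index satisfies P. *)
move=> g0; exists (\big[Num.min/1]_(i | P i) g i); last first.
  by move=> i Pi; exact: bigmin_le_cond.
by apply: (big_ind (fun x : R => 0 < x)) => // x y x0 y0; rewrite lt_min x0.
Qed.

(** * Integrals against a character *)

Section Covariance.
Variables (R : realType) (n : nat) (lam : 'I_n -> R[i]).
Local Notation RT := (measurableTypeR R).
Local Notation N := 'C(n, 2).
Implicit Types F : 'M[R]_n -> R[i].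

Definition covariant F := forall g a ubar : 'M[R]_n, GL g -> torusA a -> unipUbar ubar ->
  F (g *m a *m ubar) = apow a lam * F g.

Lemma covariant_mull F p : p \in unitmx -> covariant F -> covariant (fun y => F (p *m y)).
Proof.
move=> pu cF g a ub GLg Aa Uub; rewrite 2!mulmxA cF//.
by rewrite /GL/= unitmx_mul pu.
Qed.

Lemma covariant_tdiff F X s : 1%:M + s *: X \in unitmx ->
  covariant F -> covariant (tdiff X s F).
Proof.
move=> pu cF g a ub GLg Aa Uub.
by rewrite /tdiff cF// (covariant_mull pu cF)// mulrBr.
Qed.

Lemma covariant_iter_tdiff F X s m : 1%:M + s *: X \in unitmx ->
  covariant F -> covariant (iter m (tdiff X s) F).
Proof. by move=> pu cF; elim: m => [//|m IH]; exact: covariant_tdiff. Qed.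

Variable eps : R.
Hypothesis eps0 : 0 < eps.
Hypothesis lam_eps : forall i j : 'I_n, j = i.+1 :> nat ->
  complex.Re (lam j) - complex.Re (lam i) <= - (1 + eps).

Definition unip_majorant (t : N.-tuple RT) : R :=
  \prod_(k < N) decay eps (tnth (gs_map t) k).

(** Decomposing [unip_mx t] reduces F to its value on K times a torus character, whose modulus
    [gs_torus_bound] controls independently of F. *)
Lemma covariant_bound F M : 0 <= M -> covariant F ->
  (forall kappa, orthoK kappa -> cabs (F kappa) <= M) ->
  forall t, cabs (F (unip_mx t)) <= M * unip_majorant t.
Proof.
move=> M0 cF FM t; have [kappa [ub [Kk Uub ->]]] := unip_iwasawa t.
rewrite cF//; [|exact: orthoK_unit|exact: torusA_gs_torus].
rewrite cabsM mulrC ler_pM ?cabs_ge0 ?FM// cabs_apow.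
rewrite (_ : \sum_i _ = \sum_(0 <= c < n) ext_ord (fun i => complex.Re (lam i)) c *
    ln (Num.sqrt (gs_pivot n (unip_entry t) c 0))); last first.
  rewrite big_mkord; apply: eq_bigr => i _.
  by rewrite ext_ordE !mxE eqxx mulr1n.
apply: gs_torus_bound => [|c cn]; first exact: ltW.
have cn' := ltnW cn.
rewrite (ext_ordE _ (Ordinal cn)) (ext_ordE _ (Ordinal cn')).
exact: lam_eps.
Qed.

(** As [gs_map] preserves Lebesgue measure, the integral is that of a product of one-variable
    functions. *)
Lemma integrable_unip_majorant :
  (@lebesgue_tuple R N).-integrable setT (EFin \o unip_majorant).
Proof.
have mP : measurable_fun setT (fun t : N.-tuple RT => \prod_(k < N) decay eps (tnth t k)).
  apply: measurable_prod => k _; apply: measurableT_comp; first exact: measurable_decay.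
  exact: measurable_tnth.
have P0 t : 0 <= \prod_(k < N) decay eps (tnth (t : N.-tuple RT) k).
  by apply: prodr_ge0 => k _; exact: decay_ge0.
apply/integrableP; split.
  apply/measurable_EFinP; apply: (measurableT_comp mP).
  exact: measurable_gs_map.
under eq_integral => t _ do rewrite /= ger0_norm ?P0//.
rewrite (ge0_integral_gs_map (F := fun t => (\prod_(k < N) decay eps (tnth t k))%:E))//.
- exact: integral_prod_decay_lty.
- by apply/measurable_EFinP.
Qed.

End Covariance.

Section WhittakerIntegral.
Variables (R : realType) (n : nat).
Local Notation RT := (measurableTypeR R).
Local Notation N := 'C(n, 2).
Local Notation mu := (@lebesgue_tuple R N).
Implicit Types (tau : 'I_n.-1 -> R) (F : 'M[R]_n -> R[i]).

Definition unip_char tau (y : 'M[R]_n) : R[i] :=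
  cexp (0 +i* (2 * pi * \sum_(i < n.-1) tau i * y (ord_lo i) (ord_hi i))).

Lemma cabs_unip_char tau y : cabs (unip_char tau y) = 1.
Proof. by rewrite cabs_cexp expR0. Qed.

Lemma cmeasurable_unip_char tau :
  cmeasurable (fun t : N.-tuple RT => unip_char tau (unip_mx t)).
Proof.
pose phase (t : N.-tuple RT) : R :=
  2 * pi * \sum_(i < n.-1) tau i * unip_entry t (ord_lo i) (ord_hi i).
have mphase : measurable_fun setT phase.
  apply: measurable_funM => //.
  apply: (@measurable_sum _ (N.-tuple RT) R setT _ _
    (fun (i : 'I_n.-1) t => tau i * unip_entry t (ord_lo i) (ord_hi i))) => i.
  by apply: measurable_funM => //; exact: measurable_unip_entry.
have E t : unip_char tau (unip_mx t) = cos (phase t) +i* sin (phase t).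
  rewrite /unip_char /cexp /= expR0 mul1r.
  by under eq_bigr do rewrite unip_mxE.
split.
  under eq_fun do rewrite E /=.
  apply: (measurableT_comp _ mphase).
  exact: continuous_measurable_fun (@continuous_cos R).
under eq_fun do rewrite E /=.
apply: (measurableT_comp _ mphase).
exact: continuous_measurable_fun (@continuous_sin R).
Qed.

Definition char_integral tau F : R[i] :=
  cintegral mu (fun t => F (unip_mx t) * unip_char tau (unip_mx t)).

Lemma mul_root_mxE i s (y : 'M[R]_n) r c :
  ((1%:M + s *: root_mx R i) *m y) r c =
  y r c + (if r == ord_lo i then s * y (ord_hi i) c else 0).
Proof.
rewrite mulmxDl mul1mx -scalemxAl !mxE (bigD1 (ord_hi i))//= big1 => [|j jh]; last first.
  by rewrite mxE (negbTE jh) andbF mul0r.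
by rewrite mxE eqxx andbT addr0; case: ifP => _; rewrite ?mul1r// mul0r mulr0.
Qed.

(** On the superdiagonal, translation by 1 + s X changes only the entry attached to i, by s times a
    diagonal entry 1; the phase therefore moves by 2 pi / 2 = pi. *)
Lemma unip_char_root tau i s y : tau i * s = 1 / 2 -> unipU y ->
  unip_char tau ((1%:M + s *: root_mx R i) *m y) = - unip_char tau y.
Proof.
move=> ts [y1 y0].
have E : \sum_(j < n.-1) tau j * ((1%:M + s *: root_mx R i) *m y) (ord_lo j) (ord_hi j) =
    \sum_(j < n.-1) tau j * y (ord_lo j) (ord_hi j) + 1 / 2.
  rewrite (bigD1 i)//= [in RHS](bigD1 i)//= mul_root_mxE eqxx y1 mulr1 mulrDr ts.
  rewrite [RHS]addrAC; congr (_ + _); apply: eq_bigr => j ji.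
  rewrite mul_root_mxE ifF ?addr0//.
  by apply: contra_neqF ji => /eqP/(congr1 val)/= /val_inj.
rewrite /unip_char E mulrDr (_ : 2 * pi * (1 / 2) = pi); last by field.
rewrite /cexp /= cosDpi sinDpi.
by apply/eqP; rewrite eq_complex /=; apply/andP; split; apply/eqP; ring.
Qed.

Lemma unip_mx_unipU (t : N.-tuple RT) : unipU (unip_mx t).
Proof.
split=> [i|i j ji]; first by rewrite unip_mxE unip_entry_diag.
by rewrite unip_mxE unip_entry_low.
Qed.

(** Translating the variable turns the integral of the translate of F into minus that of F, so the
    two terms of the difference add up. *)
Lemma char_integral_tdiff tau i s F : tau i * s = 1 / 2 ->
  cmeasurable (fun t : N.-tuple RT => F (unip_mx t)) ->
  cintegrable mu (fun t => F (unip_mx t) * unip_char tau (unip_mx t)) ->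
  cintegrable mu (fun t =>
    F ((1%:M + s *: root_mx R i) *m unip_mx t) * unip_char tau (unip_mx t)) ->
  char_integral tau (tdiff (root_mx R i) s F) = 2 * char_integral tau F.
Proof.
move=> ts mF iF iF'; set X := 1%:M + s *: root_mx R i.
have A1 : @torusA R n 1%:M.
  split=> [|j]; first by rewrite scalar_mx_is_diag.
  by rewrite mxE eqxx.
have UX : unipU X by exact: unipU_root.
(* The sign absorbs that of [unip_char_root]: G after translation is the second integrand. *)
pose G (t : N.-tuple RT) := -1 * (F (unip_mx t) * unip_char tau (unip_mx t)).
have mG : cmeasurable G.
  have [mr mi] := cmeasurableM mF (cmeasurable_unip_char tau).
  rewrite /G; split; under eq_fun do rewrite mulN1r raddfN; exact: measurable_funN.
have := @cintegral_translate R n X 1%:M A1 _ mG.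
have -> : translate_jacobian (1%:M : 'M[R]_n) = 1.
  by rewrite /translate_jacobian big1// => k _; rewrite !mxE !eqxx divr1.
rewrite mul1r => E.
have E' t : G (translate_map X 1%:M t) =
    F (X *m unip_mx t) * unip_char tau (unip_mx t).
  have := @unip_mx_translate R n X 1%:M UX A1 t; rewrite !mulmx1 => XE.
  by rewrite /G XE (unip_char_root ts (unip_mx_unipU t)) mulrN mulN1r opprK.
rewrite /char_integral /tdiff.
under [in LHS]eq_fun do rewrite mulrBl.
rewrite cintegralB//.
have -> : (fun t => F (X *m unip_mx t) * unip_char tau (unip_mx t)) =
    (fun t => G (translate_map X 1%:M t)) by apply/funext => t; rewrite E'.
by rewrite E /G cintegralZl// mulN1r opprK mulr2n mulrDl mul1r.
Qed.

End WhittakerIntegral.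

Section UniformBound.
Variables (R : realType) (n : nat) (f : 'M[R]_n -> R[i]).
Local Notation RT := (measurableTypeR R).
Local Notation N := 'C(n, 2).
Local Notation mu := (@lebesgue_tuple R N).
Hypothesis sf : smooth_on (@GL R n) f.

Lemma cmeasurable_smooth q : q \in unitmx ->
  cmeasurable (fun t : N.-tuple RT => f (q *m unip_mx t)).
Proof.
move=> qu; have [cr ci] := sf 0; split.
  by apply: (measurable_unip_mx (h := fun x => complex.Re (f x)) qu) => x; case: cr => + _; apply.
by apply: (measurable_unip_mx (h := fun x => complex.Im (f x)) qu) => x; case: ci => + _; apply.
Qed.

Lemma cmeasurable_iter_tdiff (F : 'M[R]_n -> R[i]) X s m : 1%:M + s *: X \in unitmx ->
  (forall q, q \in unitmx -> cmeasurable (fun t : N.-tuple RT => F (q *m unip_mx t))) ->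
  forall q, q \in unitmx ->
  cmeasurable (fun t : N.-tuple RT => iter m (tdiff X s) F (q *m unip_mx t)).
Proof.
move=> Xu mF; elim: m => [|m IH] q qu /=; first exact: mF.
have Xqu : (1%:M + s *: X) *m q \in unitmx by rewrite unitmx_mul Xu.
have [r1 i1] := IH q qu; have [r2 i2] := IH _ Xqu.
rewrite /tdiff; split.
  under eq_fun do rewrite raddfB /= mulmxA; exact: measurable_funB.
under eq_fun do rewrite raddfB /= mulmxA; exact: measurable_funB.
Qed.

(** The points met are p kappa + x (p X kappa), a straight line whose part with x in [0, m] lies in
    a compact set common to all p, kappa and i. *)
Lemma iter_tdiff_orthoK_bound m : exists2 C : R, 0 <= C &
  forall (p kappa : 'M[R]_n) i (s : R), orthoK p -> orthoK kappa -> 0 <= s <= 1 ->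
  cabs (iter m (tdiff (root_mx R i) s) (fun y => f (p *m y)) kappa) <= C * s ^+ m.
Proof.
(* The radius 1 + m: entries of p kappa and of p X kappa are at most 1, and x is at most m. *)
have r0 : 0 <= 1 + m%:R :> R by rewrite addr_ge0.
have [Cr Cr0 HCr] := fdiff_line_bounded m r0 (fun k => proj1 (sf k)).
have [Ci Ci0 HCi] := fdiff_line_bounded m r0 (fun k => proj2 (sf k)).
exists (Cr + Ci); first exact: addr_ge0.
move=> p kappa i s Kp Kk s01; set X := root_mx R i.
have lineE (x : R) : p *m kappa + x *: (p *m X *m kappa) = p *m ((1%:M + x *: X) *m kappa).
  by rewrite mulmxDl mul1mx mulmxDr -scalemxAl -scalemxAr mulmxA.
have detE (x : R) : \det (p *m ((1%:M + x *: X) *m kappa)) ^+ 2 = 1.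
  rewrite !det_mulmx (det_unipU (unipU_root i x)).
  by rewrite mul1r exprMn !orthoK_det// mulr1.
have wE a b : `|(p *m X *m kappa) a b| <= 1.
  rewrite mxE (bigD1 (ord_hi i))//= big1 => [|c ch]; last first.
    rewrite mxE big1 ?mul0r// => d _.
    by rewrite mxE (negbTE ch) andbF mulr0.
  rewrite addr0 mxE (bigD1 (ord_lo i))//= big1 => [|d dl]; last first.
    by rewrite mxE (negbTE dl) mulr0.
  rewrite mxE !eqxx mulr1 addr0 normrM.
  by rewrite -[1]mulr1 ler_pM// orthoK_entry.
have key (h : 'M[R]_n -> R) C : (forall A w (s : R), 0 <= s <= 1 ->
    (forall x : R, GL (A + x *: w)) ->
    (forall x : R, 0 <= x <= m%:R -> compactGL (1 + m%:R) (A + x *: w)) ->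
    mx_bounded (1 + m%:R) w ->
    `|fdiff m s (fun x => h (A + x *: w)) 0| <= C * s ^+ m) ->
    `|iter m (tdiff X s) (fun y => h (p *m y)) kappa| <= C * s ^+ m.
  move=> H; have := @iter_tdiff_fdiff R n X s m (fun y => h (p *m y)) kappa 0
    (root_mx_sq0 R i).
  rewrite scale0r addr0 mul1mx => ->.
  under [X in fdiff _ _ X]eq_fun do rewrite -lineE.
  apply: H => //.
  - move=> x; rewrite /GL/= unitmxE unitfE lineE; apply/eqP => d0.
    by have := detE x; rewrite d0 expr0n/= => /eqP; rewrite eq_sym oner_eq0.
  - move=> x /andP[x0 xm]; split; last by rewrite /= lineE detE.
    move=> a b; rewrite mxE (le_trans (ler_normD _ _))// lerD//.
      by apply: orthoK_entry; exact: orthoK_mul.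
    by rewrite mxE normrM (ger0_norm x0) -[leRHS]mulr1 ler_pM.
  - by move=> a b; rewrite (le_trans (wE a b))// lerDl.
apply: (le_trans (cabs_le_ReIm _)); rewrite mulrDl; apply: lerD.
  rewrite (iter_tdiff_morph (@complex.Re R : {additive _ -> _})).
  exact: (key (fun y => complex.Re (f y))).
rewrite (iter_tdiff_morph (@complex.Im R : {additive _ -> _})).
exact: (key (fun y => complex.Im (f y))).
Qed.

End UniformBound.

(** * Unfolding the Whittaker function *)

Section Torus.
Variables (R : realType) (n : nat).
Implicit Types (a u : 'M[R]_n).

Definition torus_inv a : 'M[R]_n := diag_mx (\row_i (a i i)^-1).

Lemma torusA_inv a : torusA a -> torusA (torus_inv a).
Proof.
move=> [_ a0]; split=> [|i]; first exact: diag_mx_is_diag.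
by rewrite !mxE eqxx mulr1n invr_gt0.
Qed.

Lemma torus_invE a i : torus_inv a i i = (a i i)^-1.
Proof. by rewrite !mxE eqxx mulr1n. Qed.

Lemma mul_torus_inv a : torusA a -> a *m torus_inv a = 1%:M.
Proof.
move=> [/diag_mxP[d dE] a0]; apply/matrixP => i j.
rewrite mul_mx_diag !mxE dE mxE; case: eqVneq => [<-|_]; last by rewrite mul0r.
rewrite mxE eqxx mulr1n divff//.
by have := a0 i; rewrite dE mxE eqxx mulr1n => /lt0r_neq0.
Qed.

Lemma psi1_unip_char (y : 'M[R]_n) : psi1 y = unip_char (fun=> 1) y.
Proof. by rewrite /psi1 /unip_char; under [in RHS]eq_bigr do rewrite mul1r. Qed.

(** Superdiagonal entries add up in a product of unipotent matrices, and conjugation by a scales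
    them by the ratios a_i / a_(i+1). *)
Lemma psi1_translate u a y y' : unipU u -> unipU y -> torusA a ->
  y' *m a = u *m a *m y ->
  psi1 y' = psi1 u * unip_char (fun i => a (ord_lo i) (ord_lo i) / a (ord_hi i) (ord_hi i)) y.
Proof.
move=> [u1 u0] [y1 y0] [/diag_mxP[d dE] a0] yE.
have aE (i : 'I_n) : a i i = d 0 i by rewrite dE mxE eqxx mulr1n.
rewrite /psi1 /unip_char -cexpD /=; congr cexp.
rewrite -[RHS]/((0 + 0) +i* (_ + _)) addr0 -mulrDr -big_split/=; congr (0 +i* (_ * _)).
apply: eq_bigr => i _.
set lo := ord_lo i; set hi := ord_hi i.
have hilo : hi != lo by rewrite -val_eqE /= gtn_eqF.
have := congr1 (fun A : 'M[R]_n => A lo hi) yE.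
rewrite /= {1}dE mul_mx_diag mxE -mulmxA mxE (bigD1 lo)//= (bigD1 hi)//= big1 => [|m /andP[mlo mhi]]; last first.
  have [lom|] := ltnP lo m; last first.
    rewrite leq_eqVlt => /orP[/eqP/val_inj/eqP|mlt]; first by rewrite (negbTE mlo).
    by rewrite u0// mul0r.
  rewrite dE mul_diag_mx mxE y0 ?mulr0//.
  by rewrite ltn_neqAle lom andbT eq_sym -val_eqE/= in mhi *.
rewrite addr0 dE !mul_diag_mx !mxE u1 y1 mul1r mulr1 !eqxx !mulr1n.
have d0 : d 0 hi != 0 by rewrite -aE lt0r_neq0.
move=> E; apply: (mulIf d0); rewrite E; field; exact: d0.
Qed.

(** The exponents -rho - v, 2 rho and -(rho - v) sum to 0, which accounts for the power of a in the
    theorem. *)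
Lemma apow_cancel a (v : 'I_n -> R[i]) : torusA a ->
  cabs (apow a (fun i => - rho R i - v i)) *
  (translate_jacobian a * cabs (apow (torus_inv a) (fun i => rho R i - v i))) = 1.
Proof.
move=> Aa; have [_ a0] := Aa.
rewrite !cabs_apow translate_jacobianE// -!expRD -!big_split/= big1 ?expR0// => i _.
rewrite torus_invE lnV ?posrE//; case: (v i) => x y; rewrite /=.
by ring.
Qed.

End Torus.

Section Unfolding.
Variables (R : realType) (n : nat) (v : 'I_n -> R[i]) (f : 'M[R]_n -> R[i]).
Local Notation RT := (measurableTypeR R).
Local Notation N := 'C(n, 2).
Local Notation mu := (@lebesgue_tuple R N).
Local Notation lam := (fun i => rho R i - v i).
Hypothesis sf : smooth_on (@GL R n) f.
Hypothesis cf : covariant lam f.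

(* The substitution [x = u a y a^-1] in the integral over [U]. *)
Lemma whittaker_unfold (g u a k : 'M[R]_n) : GL g -> unipU u -> torusA a -> orthoK k ->
  g = u *m a *m k ->
  let tau i := a (ord_lo i) (ord_lo i) / a (ord_hi i) (ord_hi i) in
  cintegrable mu (fun t : N.-tuple RT => f (k^T *m unip_mx t) * unip_char tau (unip_mx t)) ->
  whittaker f g = (translate_jacobian a)%:C * ((apow (torus_inv a) lam * psi1 u) *
    char_integral tau (fun y => f (k^T *m y))).
Proof.
move=> GLg Uu Aa Kk gE tau iF.
pose H (t : N.-tuple RT) := f (invmx g *m unip_mx t) * unip_char (fun=> 1) (unip_mx t).
have mH : cmeasurable H.
  apply: cmeasurableM; last exact: cmeasurable_unip_char.
  by apply: cmeasurable_smooth => //; rewrite unitmx_inv.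
have HE t : H (translate_map u a t) = (apow (torus_inv a) lam * psi1 u) *
    (f (k^T *m unip_mx t) * unip_char tau (unip_mx t)).
  have yE := unip_mx_translate Uu Aa t.
  rewrite /H -psi1_unip_char (psi1_translate Uu (unip_mx_unipU t) Aa yE).
  (* Here x = u a y a^-1, hence g^-1 x = k^-1 y a^-1; the final identity matrix is the trivial lower
     unipotent factor in [covariant]. *)
  have -> : invmx g *m unip_mx (translate_map u a t) =
      k^T *m unip_mx t *m torus_inv a *m 1%:M.
    rewrite mulmx1; apply: (can_inj (mulKmx GLg)); rewrite mulKVmx// gE.
    rewrite !mulmxA -(mulmxA (u *m a)) (_ : k *m k^T = 1%:M)// mulmx1 -yE.
    by rewrite -mulmxA mul_torus_inv// mulmx1.
  rewrite cf.
  - by rewrite mulrACA; congr (_ * _); rewrite mulrC.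
  - by rewrite /GL/= unitmx_mul unip_mx_unit andbT; apply/orthoK_unit/orthoK_tr.
  - exact: torusA_inv.
  - by split=> [i|i j ij]; rewrite mxE ?eqxx// -val_eqE (ltn_eqF ij).
rewrite /char_integral -cintegralZl//.
transitivity (cintegral mu H).
  rewrite /whittaker /integralU /pi_action /H.
  by congr cintegral; apply/funext => t; rewrite psi1_unip_char.
rewrite -(cintegral_translate u Aa mH); congr (_ * cintegral mu _).
by apply/funext => t; rewrite HE.
Qed.

Variable eps : R.
Hypothesis eps0 : 0 < eps.
Hypothesis lam_eps : forall i j : 'I_n, j = i.+1 :> nat ->
  complex.Re (lam j) - complex.Re (lam i) <= - (1 + eps).

Let P := @unip_majorant R n eps.
Let IP : R := \int[mu]_(t in setT) P t.

Let bounded_integrable tau (F : 'M[R]_n -> R[i]) M :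
  cmeasurable (fun t : N.-tuple RT => F (unip_mx t)) ->
  (forall t, cabs (F (unip_mx t)) <= M * P t) ->
  cintegrable mu (fun t => F (unip_mx t) * unip_char tau (unip_mx t)) /\
  cabs (char_integral tau F) <= 2 * (M * IP).
Proof.
move=> mF FM; have mFc := cmeasurableM mF (cmeasurable_unip_char tau).
have iP : mu.-integrable setT (EFin \o (fun t => M * P t)).
  have := integrable_unip_majorant n eps0 => /(integrableZl measurableT M).
  by [].
have le t : cabs (F (unip_mx t) * unip_char tau (unip_mx t)) <= M * P t.
  by rewrite cabsM cabs_unip_char mulr1.
split; first exact: cintegrable_dominated mFc iP le.
have := cabs_cintegral_le mFc iP le.
by rewrite RintegralZl//; exact: integrable_unip_majorant.
Qed.

Let twist p : 'M[R]_n -> R[i] := fun y => f (p *m y).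

Let twist_diff m (i : 'I_n.-1) (s : R) (p : 'M[R]_n) := iter m (tdiff (root_mx R i) s) (twist p).

Let root_unit (i : 'I_n.-1) (s : R) : 1%:M + s *: root_mx R i \in unitmx.
Proof. by rewrite unitmxE (det_unipU (unipU_root i s)) unitr1. Qed.

Let cmeasurable_twist_diff m i s p q : orthoK p -> q \in unitmx ->
  cmeasurable (fun t : N.-tuple RT => twist_diff m i s p (q *m unip_mx t)).
Proof.
move=> Kp qu; apply: cmeasurable_iter_tdiff => // q' q'u.
rewrite /twist; under eq_fun do rewrite mulmxA.
by apply: cmeasurable_smooth => //; rewrite unitmx_mul orthoK_unit.
Qed.

(** The factor s^m is gained on K, where smoothness is uniform, and carried to U by the covariance
    that differences inherit. *)
Let twist_diff_bound m : exists2 C : R, 0 <= C &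
  forall p i s t, orthoK p -> 0 <= s <= 1 ->
    cabs (twist_diff m i s p (unip_mx t)) <= C * s ^+ m * P t.
Proof.
have [C C0 HC] := iter_tdiff_orthoK_bound sf m; exists C => // p i s t Kp s01.
apply: (covariant_bound eps0 lam_eps).
- by rewrite mulr_ge0// exprn_ge0//; case/andP: s01.
- apply: covariant_iter_tdiff => //; apply: covariant_mull => //; exact: orthoK_unit.
- by move=> kappa Kk; exact: HC.
Qed.

(* For [tau_i s = 1/2] the character changes sign under translation by [1 + s X], so each
   difference doubles the integral, while making the integrand smaller by a factor [s]. *)
Lemma char_integral_twist_bound m : exists2 C : R, 0 <= C &
  forall p tau i s, orthoK p -> 0 <= s <= 1 -> tau i * s = 1 / 2 ->
    2 ^+ m * cabs (char_integral tau (twist p)) <= C * s ^+ m.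
Proof.
have [C C0 HC] := twist_diff_bound m.
have IP0 : 0 <= IP.
  by apply: Rintegral_ge0 => t _; apply: prodr_ge0 => k _; exact: decay_ge0.
exists (2 * (C * IP)); first by rewrite !mulr_ge0.
move=> p tau i s Kp s01 ts.
have mT k : cmeasurable (fun t : N.-tuple RT => twist_diff k i s p (unip_mx t)).
  have := @cmeasurable_twist_diff k i s p 1%:M Kp (unitmx1 _ _).
  by under eq_fun do rewrite mul1mx.
have iT k : cintegrable mu (fun t =>
    twist_diff k i s p (unip_mx t) * unip_char tau (unip_mx t)).
  have [Ck _ HCk] := twist_diff_bound k.
  by have [] := @bounded_integrable tau _ _ (mT k) (fun t => HCk p i s t Kp s01).
have step k : char_integral tau (twist_diff k.+1 i s p) =
    2 * char_integral tau (twist_diff k i s p).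
  have [C1 _ HC1] := twist_diff_bound k; have [C2 _ HC2] := twist_diff_bound k.+1.
  have [|t|iF' _] := @bounded_integrable tau
    (fun y => twist_diff k i s p ((1%:M + s *: root_mx R i) *m y))
    (C1 * s ^+ k + C2 * s ^+ k.+1).
  - exact: cmeasurable_twist_diff.
  - rewrite mulrDl.
    (* Left translation by 1 + s X does not preserve K, so the translate is bounded by writing it as
       the function minus its difference, both already dominated. *)
    have -> : twist_diff k i s p ((1%:M + s *: root_mx R i) *m unip_mx t) =
        twist_diff k i s p (unip_mx t) - twist_diff k.+1 i s p (unip_mx t).
      by rewrite /twist_diff iterS /tdiff subKr.
    rewrite -lecR rmorphD -normr_cabs (le_trans (ler_normB _ _))// !normr_cabs.
    by rewrite -!rmorphD lecR lerD ?HC1 ?HC2.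
  - exact: (char_integral_tdiff ts (mT k) (iT k) iF').
have -> : 2 ^+ m * cabs (char_integral tau (twist p)) =
    cabs (char_integral tau (twist_diff m i s p)).
  elim: m {C C0 HC IP0} => [|m IH]; first by rewrite mul1r.
  rewrite step cabsM -IH exprS mulrA; congr (_ * _ * _).
  have -> : (2 : R[i]) = (2 : R)%:C by rewrite rmorph_nat.
  by rewrite cabs_real ger0_norm.
have [_] := @bounded_integrable tau _ _ (mT m) (fun t => HC p i s t Kp s01).
by move/le_trans; apply; rewrite -!mulrA; lra.
Qed.

(** Supplies the integrability that the unfolding requires, and the bound for the case where all
    ratios a_i / a_(i+1) are at most 1. *)
Lemma char_integral_twist_bound0 (i0 : 'I_n.-1) : exists2 C : R, 0 <= C &
  forall p tau, orthoK p ->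
  cintegrable mu (fun t : N.-tuple RT => twist p (unip_mx t) * unip_char tau (unip_mx t)) /\
  cabs (char_integral tau (twist p)) <= C.
Proof.
have [C C0 HC] := twist_diff_bound 0.
have IP0 : 0 <= IP.
  by apply: Rintegral_ge0 => t _; apply: prodr_ge0 => k _; exact: decay_ge0.
exists (2 * (C * IP)); first by rewrite !mulr_ge0.
move=> p tau Kp; apply: bounded_integrable => [|t].
  by apply: cmeasurable_smooth => //; exact: orthoK_unit.
by have := HC p i0 0 t Kp; rewrite lexx ler01 mulr1; apply.
Qed.

End Unfolding.

(** * The estimate *)

Lemma principal_series_covariant (R : realType) n (v : 'I_n -> R[i]) sigma f :
  is_character sigma -> principal_series v sigma f ->
  covariant (fun i => rho R i - v i) f.
Proof.
move=> [sigma1 _] [_ fE] g a ub GLg Aa Uub.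
have M1 : @signM R n 1%:M.
  split=> [|i]; first by rewrite scalar_mx_is_diag.
  by rewrite mxE eqxx; left.
by have := fE g _ a ub GLg M1 Aa Uub; rewrite mulmx1 sigma1 invr1 mul1r.
Qed.

(** Reduces the exponents l_i to a single power of the largest ratio: if that ratio is at most 1 so
    is every factor, otherwise it replaces each ratio. *)
Lemma prod_expr_le_max (R : realType) m (tau : 'I_m -> R) (l : 'I_m -> nat) j :
  (forall i, 0 < tau i) -> (forall i, tau i <= tau j) ->
  \prod_i tau i ^+ l i <= Num.max 1 (tau j ^+ (\sum_i l i)).
Proof.
move=> tau0 tauj; have [tj|/ltW tj] := leP (tau j) 1.
  rewrite le_max; apply/orP; left; apply: prodr_ile1 => i _.
  have t0 := ltW (tau0 i); have t1 := le_trans (tauj i) tj.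
  by rewrite exprn_ge0//= exprn_ile1.
rewrite le_max; apply/orP; right; rewrite expr_sum; apply: ler_prod => i _.
by have t0 := ltW (tau0 i); rewrite exprn_ge0//= lerXn2r ?nnegrE// (le_trans t0).
Qed.

Theorem theorem1p4 (R : realType) (n : nat) (hn : (3 <= n)%N)
    (v : 'I_n -> R[i])
    (hv : forall i j : 'I_n, (i < j)%N -> complex.Re (v i) < complex.Re (v j))
    (sigma : 'M[R]_n -> R[i]) (hsigma : is_character sigma)
    (f : 'M[R]_n -> R[i]) (hf : principal_series v sigma f)
    (l : 'I_n.-1 -> nat) :
  exists C : R, forall g u a k : 'M[R]_n,
    GL g -> unipU u -> torusA a -> orthoK k -> g = u *m a *m k ->
    `| apow a (fun i => - rho R i - v i)
       * (\prod_(i < n.-1)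
            (a (ord_lo i) (ord_lo i) / a (ord_hi i) (ord_hi i)) ^+ l i)%:C
       * whittaker f g | <= C%:C.
Proof.
have cf := principal_series_covariant hsigma hf; have sf := proj1 hf.
have [eps eps0 epsP] := @finite_pos_lower_bound R ('I_n * 'I_n)%type
  (fun p => (p.1 < p.2)%N) (fun p => complex.Re (v p.2) - complex.Re (v p.1))
  (fun p p12 => etrans (subr_gt0 _ _) (hv _ _ p12)).
(* From i to i + 1, rho drops by 1 and the real part of v grows by at least eps. *)
have lam_eps (i j : 'I_n) : j = i.+1 :> nat ->
    complex.Re (rho R j - v j) - complex.Re (rho R i - v i) <= - (1 + eps).
  move=> ji; have := epsP (i, j); rewrite /= ji => /(_ (ltnSn _)).
  by rewrite !raddfB/= ji -(natr1 i); lra.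
have n1 : (0 < n.-1)%N by lia.
pose i0 : 'I_n.-1 := Ordinal n1.
have [C0 C0_ge0 HC0] := char_integral_twist_bound0 sf cf eps0 lam_eps i0.
have [C C_ge0 HC] := char_integral_twist_bound sf cf eps0 lam_eps (\sum_i l i).
exists (C0 + C) => g u a k GLg Uu Aa Kk gE.
have [_ a0] := Aa.
pose tau i := a (ord_lo i) (ord_lo i) / a (ord_hi i) (ord_hi i).
have tau0 i : 0 < tau i by rewrite divr_gt0.
have [iF W0] := HC0 k^T tau (orthoK_tr Kk).
rewrite (whittaker_unfold sf cf GLg Uu Aa Kk gE iF).
have cabsM6 (x1 x2 x3 x4 x5 x6 : R[i]) : cabs (x1 * x2 * (x3 * (x4 * x5 * x6))) =
    cabs x1 * cabs x2 * (cabs x3 * (cabs x4 * cabs x5 * cabs x6)) by rewrite !cabsM.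
rewrite normr_cabs lecR cabsM6 psi1_unip_char cabs_unip_char mulr1 !cabs_real.
set W := cabs (char_integral _ _) in W0 *.
have W_ge0 : 0 <= W by exact: cabs_ge0.
have J0 : 0 <= translate_jacobian a by rewrite prodr_ge0// => i _; rewrite divr_ge0// ltW.
have T0 : 0 <= \prod_i tau i ^+ l i by rewrite prodr_ge0// => i _; rewrite exprn_ge0// ltW.
rewrite (ger0_norm J0) (ger0_norm T0).
rewrite (_ : _ * _ * _ = (cabs (apow a (fun i => - rho R i - v i)) *
  (translate_jacobian a * cabs (apow (torus_inv a) (fun i => rho R i - v i)))) *
  (\prod_i tau i ^+ l i * W)); last by ring.
rewrite apow_cancel// mul1r.
have [j _ tauj] := @arg_maxP _ _ _ i0 xpredT tau isT.
apply: (le_trans (ler_wpM2r W_ge0 (prod_expr_le_max l tau0 (fun i => tauj i isT)))).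
(* For a largest ratio at most 1 the undifferenced bound is enough; above 1, the step 1 / (2 t) is
   below 1 as required. *)
have [tj|tj] := leP (tau j) 1.
  rewrite (_ : Num.max _ _ = 1) ?mul1r; first by rewrite (le_trans W0)// lerDl.
  by apply/max_idPl; rewrite exprn_ile1// ltW.
rewrite (_ : Num.max _ _ = tau j ^+ (\sum_i l i)); last first.
  by apply/max_idPr; rewrite exprn_ege1// ltW.
set L := \sum_i l i in HC *.
have t2 : 0 < 2 * tau j by rewrite mulr_gt0.
have s01 : 0 <= (2 * tau j)^-1 <= 1.
  by rewrite invr_ge0 (ltW t2)/= invf_le1//; lra.
have ts : tau j * (2 * tau j)^-1 = 1 / 2 by field; rewrite gt_eqF.
have := HC k^T tau j _ (orthoK_tr Kk) s01 ts; rewrite -/W => H.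
apply: (@le_trans _ _ C); last by rewrite lerDr.
(* Multiplying by (2 t)^L cancels s^L exactly. *)
have H2 : 2 ^+ L * W * (2 * tau j) ^+ L <= C.
  apply: (le_trans (ler_wpM2r (exprn_ge0 L (ltW t2)) H)).
  by rewrite -mulrA -exprMn mulVf ?gt_eqF// expr1n mulr1.
apply: le_trans H2.
(* The surplus factor 4^L is at least 1 and is dropped. *)
have -> : 2 ^+ L * W * (2 * tau j) ^+ L = 2 ^+ L * 2 ^+ L * (tau j ^+ L * W).
  by rewrite exprMn; ring.
have tW : 0 <= tau j ^+ L * W by rewrite mulr_ge0// exprn_ge0// ltW.
by rewrite ler_peMl// mulr_ege1// exprn_ege1// ler1n.
Qed.
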